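(* The only surfaces of revolution in Euclidean $3$-space $E^3$ (with nowhere vanishing Gauss curvature) for which the sum $R$ of the principal radii of curvature is constant are (open parts of): (i) spheres, which are of finite $III$-type $1$; (ii) catenoids, which are of finite null $III$-type $1$; (iii) the parallel surfaces to the catenoids, which are of finite null $III$-type $2$.
   Context: Surface of revolution: a surface with position vector $\boldsymbol{x}(u,v)=(f(u)\cos v,\,f(u)\sin v,\,g(u))$, $u\in J$, $v\in[0,2\pi)$, up to rigid motion of $E^3$, where $J\subset\mathbb{R}$ is an open interval, $f,g$ are smooth, $f>0$, and the profile curve $(f(u),0,g(u))$ is regular (it may be taken with arc-length parametrization, $f'^2+g'^2=1$). All surfaces are assumed to have no parabolic points, i.e. Gauss curvature $K\ne0$ everywhere. Let $\boldsymbol{N}$ be the unit normal and $H$ the mean curvature. $R=\frac{2H}{K}$ is the sum of the two principal radii of curvature (reciprocals of the principal curvatures). The third fundamental form is $III=e_{ij}du^idu^j$ with $e_{ij}=\langle \boldsymbol{N}_{/i},\boldsymbol{N}_{/j}\rangle$, where $f_{/i}=\partial f/\partial u^i$; it is a Riemannian metric because $K\neq0$. The second Laplace operator with respect to $III$ is $\Delta^{III}f=-e^{ij}\nabla^{III}_i f_{/j}$, where $(e^{ij})$ is the inverse of $(e_{ij})$ and $\nabla^{III}$ is the covariant derivative of the Levi-Civita connection of $III$; it acts componentwise on vector-valued functions. A surface with position vector $\boldsymbol{x}$ is of finite $III$-type $k$ if $\boldsymbol{x}=\boldsymbol{x}_0+\boldsymbol{x}_1+\dots+\boldsymbol{x}_k$,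 where $\boldsymbol{x}_0$ is a fixed vector and $\boldsymbol{x}_1,\dots,\boldsymbol{x}_k$ are nonconstant smooth vector-valued maps with $\Delta^{III}\boldsymbol{x}_i=\lambda_i\boldsymbol{x}_i$ for mutually distinct real numbers $\lambda_1,\dots,\lambda_k$. It is of finite null $III$-type $k$ if in addition one of the eigenvalues $\lambda_1,\dots,\lambda_k$ is $0$. A parallel surface of a surface $S$ with position vector $\boldsymbol{x}$ is a surface $S^*$ with position vector $\boldsymbol{x}^*=\boldsymbol{x}+\mu\boldsymbol{N}$, where $\mu\neq0$ is a constant such that $1-2\mu H+\mu^2K\neq0$ on $S$. A catenoid is a (part of a) non-planar minimal surface of revolution. *)

(* Defs.v *)
From Stdlib Require Import Reals.
From Coquelicot Require Import Coquelicot.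
Open Scope R_scope.

(* A product of R's, so that Coquelicot's [plus], [minus], [scal] and [sum_n]
   provide the vector space structure. *)
Definition vec3 : Type := (R * R * R)%type.

Definition c1 (p : vec3) : R := fst (fst p).
Definition c2 (p : vec3) : R := snd (fst p).
Definition c3 (p : vec3) : R := snd p.

Definition dot (p q : vec3) : R := c1 p * c1 q + c2 p * c2 q + c3 p * c3 q.

Definition cross (p q : vec3) : vec3 :=
  (c2 p * c3 q - c3 p * c2 q,
   c3 p * c1 q - c1 p * c3 q,
   c1 p * c2 q - c2 p * c1 q).

Definition enorm (p : vec3) : R := sqrt (dot p p).

(* Orientation preserving isometries of Euclidean 3-space: the images
   e1, e2, e3 of the standard basis form a positive orthonormal frame. *)
Definition rigid_motion (T : vec3 -> vec3) : Prop :=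
  exists e1 e2 e3 b : vec3,
    dot e1 e1 = 1 /\ dot e2 e2 = 1 /\ dot e1 e2 = 0 /\ e3 = cross e1 e2 /\
    forall p : vec3,
      T p = plus b (plus (scal (c1 p) e1)
                         (plus (scal (c2 p) e2) (scal (c3 p) e3))).

Definition parameter_interval (a b : Rbar) (u : R) : Prop :=
  Rbar_lt a u /\ Rbar_lt u b.

Variant coord : Set := cu | cv.

Definition sum2 (F : coord -> R) : R := F cu + F cv.

Definition partial (i : coord) (h : R -> R -> R) : R -> R -> R :=
  match i with
  | cu => fun u v => Derive (fun t => h t v) u
  | cv => fun u v => Derive (fun t => h u t) v
  end.

Definition vpartial (i : coord) (Y : R -> R -> vec3) : R -> R -> vec3 :=
  fun u v => (partial i (fun s t => c1 (Y s t)) u v,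
              partial i (fun s t => c2 (Y s t)) u v,
              partial i (fun s t => c3 (Y s t)) u v).

Fixpoint Ck (n : nat) (J : R -> Prop) (h : R -> R -> R) : Prop :=
  (forall u v, J u -> continuity_2d_pt h u v) /\
  match n with
  | O => True
  | S m =>
      (forall u v, J u ->
         ex_derive (fun t => h t v) u /\ ex_derive (fun t => h u t) v) /\
      forall i, Ck m J (partial i h)
  end.

Definition smooth2 (J : R -> Prop) (h : R -> R -> R) : Prop :=
  forall n, Ck n J h.

Definition vsmooth2 (J : R -> Prop) (Y : R -> R -> vec3) : Prop :=
  smooth2 J (fun u v => c1 (Y u v)) /\
  smooth2 J (fun u v => c2 (Y u v)) /\
  smooth2 J (fun u v => c3 (Y u v)).

Definition smooth1 (J : R -> Prop) (h : R -> R) : Prop :=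
  forall n u, J u -> ex_derive_n h n u.

Definition normal (X : R -> R -> vec3) (u v : R) : vec3 :=
  let w := cross (vpartial cu X u v) (vpartial cv X u v) in
  scal (/ enorm w) w.

Definition I_form (X : R -> R -> vec3) (i j : coord) (u v : R) : R :=
  dot (vpartial i X u v) (vpartial j X u v).

Definition II_form (X : R -> R -> vec3) (i j : coord) (u v : R) : R :=
  dot (vpartial i (vpartial j X) u v) (normal X u v).

Definition III_form (X : R -> R -> vec3) (i j : coord) (u v : R) : R :=
  dot (vpartial i (normal X) u v) (vpartial j (normal X) u v).

Definition det2 (B : coord -> coord -> R) : R :=
  B cu cu * B cv cv - B cu cv * B cv cu.

Definition inv2 (B : coord -> coord -> R) (i j : coord) : R :=
  match i, j with
  | cu, cu => B cv cv / det2 B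
  | cv, cv => B cu cu / det2 B
  | cu, cv => - B cu cv / det2 B
  | cv, cu => - B cv cu / det2 B
  end.

Definition gauss_curvature (X : R -> R -> vec3) (u v : R) : R :=
  det2 (fun i j => II_form X i j u v) / det2 (fun i j => I_form X i j u v).

(* H = (1/2) g^{ij} h_{ij}. *)
Definition mean_curvature (X : R -> R -> vec3) (u v : R) : R :=
  / 2 * sum2 (fun i => sum2 (fun j =>
    inv2 (fun k l => I_form X k l u v) i j * II_form X i j u v)).

Definition sum_radii (X : R -> R -> vec3) (u v : R) : R :=
  2 * mean_curvature X u v / gauss_curvature X u v.

Definition III_inv (X : R -> R -> vec3) (i j : coord) (u v : R) : R :=
  inv2 (fun k l => III_form X k l u v) i j.

(* Gamma^k_{ij} of the Levi-Civita connection of III. *)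
Definition III_christoffel (X : R -> R -> vec3) (k i j : coord) (u v : R) : R :=
  / 2 * sum2 (fun l => III_inv X k l u v *
    (partial i (III_form X j l) u v + partial j (III_form X i l) u v
     - partial l (III_form X i j) u v)).

Definition III_laplacian (X : R -> R -> vec3) (h : R -> R -> R) (u v : R) : R :=
  - sum2 (fun i => sum2 (fun j => III_inv X i j u v *
      (partial i (partial j h) u v
       - sum2 (fun k => III_christoffel X k i j u v * partial k h u v)))).

Definition III_vlaplacian (X : R -> R -> vec3) (Y : R -> R -> vec3)
    (u v : R) : vec3 :=
  (III_laplacian X (fun s t => c1 (Y s t)) u v,
   III_laplacian X (fun s t => c2 (Y s t)) u v,
   III_laplacian X (fun s t => c3 (Y s t)) u v).

(* The angle v ranges over R instead of [0, 2 PI); everything attached to the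
   surface is 2 PI-periodic in v.  Values of X at u outside J are irrelevant. *)
Definition surface_of_revolution (J : R -> Prop) (X : R -> R -> vec3) : Prop :=
  exists (T : vec3 -> vec3) (f g : R -> R),
    rigid_motion T /\ smooth1 J f /\ smooth1 J g /\
    (forall u, J u -> 0 < f u) /\
    (forall u, J u -> Derive f u <> 0 \/ Derive g u <> 0) /\
    forall u v, J u -> X u v = T (f u * cos v, f u * sin v, g u).

Definition no_parabolic_points (J : R -> Prop) (X : R -> R -> vec3) : Prop :=
  forall u v, J u -> gauss_curvature X u v <> 0.

Definition constant_sum_radii (J : R -> Prop) (X : R -> R -> vec3) : Prop :=
  exists c : R, forall u v, J u -> sum_radii X u v = c.

Definition planar (J : R -> Prop) (X : R -> R -> vec3) : Prop :=
  exists (n : vec3) (d : R), n <> zero /\ forall u v, J u -> dot n (X u v) = d.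

Definition minimal (J : R -> Prop) (X : R -> R -> vec3) : Prop :=
  forall u v, J u -> mean_curvature X u v = 0.

(* Open part of a sphere, parametrized as a surface of revolution. *)
Definition spherical (J : R -> Prop) (X : R -> R -> vec3) : Prop :=
  surface_of_revolution J X /\
  exists (c : vec3) (r : R),
    0 < r /\ forall u v, J u -> enorm (minus (X u v) c) = r.

Definition catenoid (J : R -> Prop) (X : R -> R -> vec3) : Prop :=
  surface_of_revolution J X /\ minimal J X /\ ~ planar J X.

(* X is a parallel surface of Y. *)
Definition parallel_surface (J : R -> Prop) (Y X : R -> R -> vec3) : Prop :=
  exists mu : R,
    mu <> 0 /\
    (forall u v, J u ->
       1 - 2 * mu * mean_curvature Y u v + mu ^ 2 * gauss_curvature Y u v <> 0) /\
    forall u v, J u -> X u v = plus (Y u v) (scal mu (normal Y u v)).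

Definition catenoid_parallel (J : R -> Prop) (X : R -> R -> vec3) : Prop :=
  exists Y : R -> R -> vec3, catenoid J Y /\ parallel_surface J Y X.

(* X = x_0 + x_1 + ... + x_k ([sum_n x k] has k + 1 terms). *)
Definition III_decomposition (J : R -> Prop) (X : R -> R -> vec3) (k : nat)
    (x : nat -> R -> R -> vec3) (lambda : nat -> R) : Prop :=
  (exists p : vec3, forall u v, J u -> x O u v = p) /\
  (forall i, (1 <= i <= k)%nat ->
     vsmooth2 J (x i) /\
     (forall u v, J u -> x i u (v + 2 * PI) = x i u v) /\
     (exists u v u' v', J u /\ J u' /\ x i u v <> x i u' v') /\
     (forall u v, J u ->
        III_vlaplacian X (x i) u v = scal (lambda i) (x i u v))) /\
  (forall i j, (1 <= i <= k)%nat -> (1 <= j <= k)%nat -> i <> j ->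
     lambda i <> lambda j) /\
  (forall u v, J u -> X u v = sum_n (fun i => x i u v) k).

Definition finite_III_type (J : R -> Prop) (X : R -> R -> vec3) (k : nat) : Prop :=
  exists x lambda, III_decomposition J X k x lambda.

Definition finite_null_III_type (J : R -> Prop) (X : R -> R -> vec3) (k : nat)
    : Prop :=
  exists x lambda, III_decomposition J X k x lambda /\
    exists i, (1 <= i <= k)%nat /\ lambda i = 0.

(* Main.v *)
From Stdlib Require Import Reals Lra Lia.
From Coquelicot Require Import Coquelicot.
Require Import Defs.
Open Scope R_scope.

(** Write the profile curve with unit tangent [(cos phi, sin phi)], speed [w] and
    turning rate [k = phi'].  The principal radii of the surface are [w / k] and
    [f / sin phi], and the normal is [(- sin phi, cos phi)] turned about the axis.
    Passing to the parallel surface at distance [m] subtracts [m] from both radii.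
    Hence, if the sum of the radii is the constant [2 m], the parallel surface at
    distance [m] has opposite radii, that is, it is minimal, wherever it is a
    surface at all.  To see that it is a surface everywhere or nowhere, one computes
    that [(f - m sin phi) sin phi] has derivative zero
    ([parallel_rad_tsin_constant]).  If this constant is zero then [f = m sin phi]
    and [w = m k], which is a sphere; otherwise the parallel surface is a catenoid,
    and the given surface is this catenoid or one of its parallel surfaces
    ([constant_sum_radii_classification]).

    In the converse direction each family is brought to the same profile form:
    [f = t sin phi], [w = t k] for a sphere of radius [|t|]
    ([spherical_generated]), and opposite radii with [sin phi] nowhere zero for a
    catenoid, because [f sin phi] is constant and vanishes only for planes
    ([catenoid_generated]).  The sum of the radii can then be read off.

    For the finite type, the third fundamental form is
    [d phi^2 + sin^2 phi dv^2], the metric of the unit sphere pulled back by the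
    normal.  Its Laplacian (with the geometric sign) has eigenvalue 2 on the normal
    ([normal_eigenfield]), and eigenvalue 0 on the position vector of a catenoid,
    since the spherical image of a minimal surface is conformal
    ([minimal_eigenfield]).  A sphere is a point plus a multiple of its normal, and
    a parallel surface of a catenoid is the catenoid plus a multiple of its normal;
    parallel surfaces share their normals, hence their third fundamental form.

    All vector fields in play have components depending on [u] only in the
    orthonormal frame that turns with [v] about the axis.  In this frame the
    derivative in [v] is algebraic, so that every geometric quantity reduces to an
    identity between functions of [u]. *)

(** * Smooth functions on an open interval *)

Definition interval (J : R -> Prop) : Prop :=
  open J /\ forall u v t, J u -> J v -> u <= t <= v -> J t.

Lemma parameter_interval_interval (a b : Rbar) : interval (parameter_interval a b).
Proof.
split.
- apply open_and; [apply open_Rbar_gt | apply open_Rbar_lt].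
- intros u v t [Hu _] [_ Hv] [H1 H2]; split.
  + apply Rbar_lt_le_trans with u; [exact Hu | exact H1].
  + apply Rbar_le_lt_trans with v; [exact H2 | exact Hv].
Qed.

Lemma parameter_interval_nonempty (a b : Rbar) :
  Rbar_lt a b -> exists u, parameter_interval a b u.
Proof.
intros H; unfold parameter_interval.
destruct a as [x| |], b as [y| |]; simpl in H; try easy.
- exists ((x + y) / 2); simpl; lra.
- exists (x + 1); simpl; lra.
- exists (y - 1); simpl; lra.
- exists 0; simpl; tauto.
Qed.

Lemma constant_of_derive_zero (J : R -> Prop) (h : R -> R) :
  interval J -> (forall u, J u -> is_derive h u 0) ->
  forall u v, J u -> J v -> h u = h v.
Proof.
intros [_ HJ] Hh.
assert (Hlt : forall u v, J u -> J v -> u < v -> h u = h v).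
{ intros u v Ju Jv Huv.
  apply (eq_is_derive h); [|exact Huv].
  intros t Ht; apply Hh, (HJ u v); assumption. }
intros u v Ju Jv; destruct (Rtotal_order u v) as [H|[H|H]].
- now apply Hlt.
- now rewrite H.
- now symmetry; apply Hlt.
Qed.

(** The function [h / |h|] is locally constant, hence has derivative zero: no
    intermediate value theorem is needed. *)
Lemma constant_sign (J : R -> Prop) (h : R -> R) :
  interval J -> (exists u, J u) -> (forall u, J u -> ex_derive h u) ->
  (forall u, J u -> h u <> 0) ->
  exists sg, (sg = 1 \/ sg = -1) /\ forall u, J u -> 0 < sg * h u.
Proof.
intros HJ [u0 Ju0] Hd Hn.
assert (Hc : forall u, J u -> h u / sqrt (h u * h u) = h u0 / sqrt (h u0 * h u0)).
{ intros u Ju.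
  apply (constant_of_derive_zero J (fun t => h t / sqrt (h t * h t))); trivial.
  intros t Jt.
  assert (Hp : 0 < h t * h t) by (apply Rsqr_pos_lt; auto).
  assert (Hs : 0 < sqrt (h t * h t)) by now apply sqrt_lt_R0.
  auto_derive.
  - repeat split; auto; lra.
  - assert (Hq : sqrt (h t * h t) * sqrt (h t * h t) = h t * h t)
      by (apply sqrt_sqrt; lra).
    change (Derive (fun x => h x) t) with (Derive h t).
    set (q := sqrt (h t * h t)) in *; set (d := Derive _ t).
    replace (h t * h t) with (q * q) by exact Hq.
    transitivity (d * (q * q - h t * h t) / (q * q * q)); 
      [|replace (q * q - h t * h t) with 0 by lra; field; lra].
    field; lra. }
assert (Hr : forall x, 0 < x -> sqrt (x * x) = x) by (intros; apply sqrt_square; lra).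
assert (Hl : forall x, x < 0 -> sqrt (x * x) = - x).
{ intros x Hx; replace (x * x) with (- x * - x) by ring; apply Hr; lra. }
assert (Hp : forall x, 0 < x -> x / sqrt (x * x) = 1)
  by (intros x Hx; rewrite Hr; [field; lra|exact Hx]).
assert (Hm : forall x, x < 0 -> x / sqrt (x * x) = -1)
  by (intros x Hx; rewrite Hl; [field; lra|exact Hx]).
destruct (Rdichotomy _ _ (Hn _ Ju0)) as [H0|H0].
- exists (-1); split; [now right|]; intros u Ju; specialize (Hc u Ju).
  rewrite (Hm _ H0) in Hc.
  destruct (Rdichotomy _ _ (Hn _ Ju)) as [H|H]; [lra|].
  rewrite (Hp _ H) in Hc; lra.
- exists 1; split; [now left|]; intros u Ju; specialize (Hc u Ju).
  rewrite (Hp _ H0) in Hc.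
  destruct (Rdichotomy _ _ (Hn _ Ju)) as [H|H]; [|lra].
  rewrite (Hm _ H) in Hc; lra.
Qed.

(** Unlike [ex_derive_n], which differentiates last, this unfolds from the first
    derivative on, which is the shape that inductions over the product and chain
    rules need. *)
Fixpoint differentiable_upto (n : nat) (J : R -> Prop) (h : R -> R) : Prop :=
  match n with
  | O => True
  | S m => (forall u, J u -> ex_derive h u) /\ differentiable_upto m J (Derive h)
  end.

Lemma smooth1_iff (J : R -> Prop) (h : R -> R) :
  smooth1 J h <-> forall n, differentiable_upto n J h.
Proof.
split.
- intros H n; revert h H; induction n as [|n IH]; intros h H; simpl; trivial.
  split; [exact (H 1%nat)|].
  apply IH; intros [|m] u Ju; simpl; trivial.
  apply ex_derive_ext with (Derive_n h (S m)); [|exact (H (S (S m)) u Ju)].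
  intros t; change (Derive h) with (Derive_n h 1); rewrite Derive_n_comp; f_equal; lia.
- intros H n u Ju; specialize (H n); revert h H; induction n as [|[|n] IH]; intros h H.
  + exact I.
  + apply H, Ju.
  + destruct H as [_ H]; apply IH in H.
    apply ex_derive_ext with (Derive_n (Derive h) n); [|exact H].
    intros t.
    change (Derive_n (Derive_n h 1) n t = Derive_n h (S n) t).
    rewrite Derive_n_comp; f_equal; lia.
Qed.

Lemma smooth1_ex_derive (J : R -> Prop) (h : R -> R) (u : R) :
  smooth1 J h -> J u -> ex_derive h u.
Proof. intros H; exact (H 1%nat u). Qed.

Lemma smooth1_is_derive (J : R -> Prop) (h : R -> R) (u : R) :
  smooth1 J h -> J u -> is_derive h u (Derive h u).
Proof. intros; apply Derive_correct; now apply (smooth1_ex_derive J). Qed.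

Lemma smooth1_Derive (J : R -> Prop) (h : R -> R) : smooth1 J h -> smooth1 J (Derive h).
Proof.
rewrite !smooth1_iff; intros H n; exact (proj2 (H (S n))).
Qed.

Lemma differentiable_upto_ext (n : nat) (J : R -> Prop) (h k : R -> R) :
  open J -> (forall u, J u -> h u = k u) ->
  differentiable_upto n J h -> differentiable_upto n J k.
Proof.
intros HJ; revert h k; induction n as [|n IH]; intros h k E H; trivial.
destruct H as [H1 H2]; split.
- intros u Ju; apply ex_derive_ext_loc with h; [|auto].
  now apply (filter_imp J); [|apply HJ].
- apply IH with (Derive h); trivial.
  intros u Ju; apply Derive_ext_loc.
  now apply (filter_imp J); [|apply HJ].
Qed.

Lemma differentiable_upto_S (n : nat) (J : R -> Prop) (h k : R -> R) :
  open J -> (forall u, J u -> is_derive h u (k u)) ->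
  differentiable_upto n J k -> differentiable_upto (S n) J h.
Proof.
intros HJ E H; split.
- intros u Ju; exists (k u); auto.
- apply differentiable_upto_ext with k; trivial.
  intros u Ju; symmetry; apply is_derive_unique; auto.
Qed.

Lemma differentiable_upto_pred (n : nat) (J : R -> Prop) (h : R -> R) :
  differentiable_upto (S n) J h -> differentiable_upto n J h.
Proof.
revert h; induction n as [|n IH]; intros h H; [exact I|].
destruct H as [H1 H2]; split; auto.
Qed.

Lemma differentiable_upto_plus (n : nat) (J : R -> Prop) (h k : R -> R) :
  open J -> differentiable_upto n J h -> differentiable_upto n J k ->
  differentiable_upto n J (fun u => h u + k u).
Proof.
intros HJ; revert h k; induction n as [|n IH]; intros h k Hh Hk; [exact I|].
destruct Hh as [Hh Hh'], Hk as [Hk Hk'].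
apply differentiable_upto_S with (fun u => Derive h u + Derive k u); auto.
intros u Ju; apply @is_derive_plus; apply Derive_correct; auto.
Qed.

Lemma differentiable_upto_mult (n : nat) (J : R -> Prop) (h k : R -> R) :
  open J -> differentiable_upto n J h -> differentiable_upto n J k ->
  differentiable_upto n J (fun u => h u * k u).
Proof.
intros HJ; revert h k; induction n as [|n IH]; intros h k Hh Hk; [exact I|].
pose proof (differentiable_upto_pred _ _ _ Hh) as Hh0.
pose proof (differentiable_upto_pred _ _ _ Hk) as Hk0.
destruct Hh as [Hh Hh'], Hk as [Hk Hk'].
apply differentiable_upto_S with (fun u => Derive h u * k u + h u * Derive k u); trivial.
- intros u Ju; auto_derive; [now split; auto|].
  change (Derive (fun x => h x) u) with (Derive h u).
  change (Derive (fun x => k x) u) with (Derive k u); ring.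
- apply differentiable_upto_plus; auto.
Qed.

Lemma smooth1_ext (J : R -> Prop) (h k : R -> R) :
  open J -> (forall u, J u -> h u = k u) -> smooth1 J h -> smooth1 J k.
Proof.
rewrite !smooth1_iff; intros HJ E H n; now apply differentiable_upto_ext with h.
Qed.

Lemma smooth1_const (J : R -> Prop) (x : R) : open J -> smooth1 J (fun _ => x).
Proof.
intros HJ; apply smooth1_iff; intros n; revert x; induction n as [|n IH]; intros x.
- exact I.
- apply differentiable_upto_S with (fun _ => 0); auto.
  intros u _; apply @is_derive_const.
Qed.

Lemma smooth1_plus (J : R -> Prop) (h k : R -> R) :
  open J -> smooth1 J h -> smooth1 J k -> smooth1 J (fun u => h u + k u).
Proof.
rewrite !smooth1_iff; intros; now apply differentiable_upto_plus.
Qed.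

Lemma smooth1_mult (J : R -> Prop) (h k : R -> R) :
  open J -> smooth1 J h -> smooth1 J k -> smooth1 J (fun u => h u * k u).
Proof.
rewrite !smooth1_iff; intros; now apply differentiable_upto_mult.
Qed.

Lemma smooth1_scal (J : R -> Prop) (x : R) (h : R -> R) :
  open J -> smooth1 J h -> smooth1 J (fun u => x * h u).
Proof. intros HJ H; apply smooth1_mult; trivial; now apply smooth1_const. Qed.

Lemma smooth1_opp (J : R -> Prop) (h : R -> R) :
  open J -> smooth1 J h -> smooth1 J (fun u => - h u).
Proof.
intros HJ H; apply smooth1_ext with (fun u => -1 * h u); trivial.
- intros; ring.
- now apply smooth1_scal.
Qed.

Lemma smooth1_minus (J : R -> Prop) (h k : R -> R) :
  open J -> smooth1 J h -> smooth1 J k -> smooth1 J (fun u => h u - k u).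
Proof. intros; apply smooth1_plus; trivial; now apply smooth1_opp. Qed.

(** The derivative of the reciprocal is again built from the reciprocal by
    products, so its smoothness bootstraps; the same mechanism serves the square
    root below. *)
Lemma smooth1_inv (J : R -> Prop) (h : R -> R) :
  open J -> smooth1 J h -> (forall u, J u -> h u <> 0) -> smooth1 J (fun u => / h u).
Proof.
intros HJ Hh Hn; apply smooth1_iff; induction n as [|n IH]; [exact I|].
apply differentiable_upto_S with (fun u => (-1 * Derive h u) * (/ h u * / h u)); trivial.
- intros u Ju; auto_derive.
  + split; [now apply (smooth1_ex_derive J) | now auto].
  + change (Derive (fun x => h x) u) with (Derive h u); field; auto.
- apply differentiable_upto_mult; trivial.
  + apply -> smooth1_iff; apply smooth1_scal, smooth1_Derive; trivial.
  + now apply differentiable_upto_mult.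
Qed.

Lemma smooth1_div (J : R -> Prop) (h k : R -> R) :
  open J -> smooth1 J h -> smooth1 J k -> (forall u, J u -> k u <> 0) ->
  smooth1 J (fun u => h u / k u).
Proof. intros; apply smooth1_mult; trivial; now apply smooth1_inv. Qed.

Lemma smooth1_sqrt (J : R -> Prop) (h : R -> R) :
  open J -> smooth1 J h -> (forall u, J u -> 0 < h u) -> smooth1 J (fun u => sqrt (h u)).
Proof.
intros HJ Hh Hp.
assert (Hi : smooth1 J (fun u => Derive h u / (2 * h u))).
{ apply smooth1_div; trivial.
  - now apply smooth1_Derive.
  - now apply smooth1_scal.
  - intros u Ju; specialize (Hp u Ju); lra. }
apply smooth1_iff; induction n as [|n IH]; [exact I|].
apply differentiable_upto_S with (fun u => sqrt (h u) * (Derive h u / (2 * h u))); trivial.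
- intros u Ju; specialize (Hp u Ju); auto_derive.
  + split; [now apply (smooth1_ex_derive J) | now split].
  + change (Derive (fun x => h x) u) with (Derive h u).
    assert (Hq : sqrt (h u) * sqrt (h u) = h u) by (apply sqrt_sqrt; lra).
    assert (0 < sqrt (h u)) by now apply sqrt_lt_R0.
    rewrite <- Hq at 3; field; lra.
- apply differentiable_upto_mult; trivial.
  now apply -> smooth1_iff.
Qed.

(** * Moving frames and revolving fields *)

Record frame : Type := Frame {
  fe1 : vec3; fe2 : vec3; fe3 : vec3;
  frame_11 : dot fe1 fe1 = 1;
  frame_22 : dot fe2 fe2 = 1;
  frame_12 : dot fe1 fe2 = 0;
  frame_3 : fe3 = cross fe1 fe2
}.

Definition comb (F : frame) (x y z : R) : vec3 :=
  plus (scal x (fe1 F)) (plus (scal y (fe2 F)) (scal z (fe3 F))).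

Lemma vec3_eq (p q : vec3) : c1 p = c1 q -> c2 p = c2 q -> c3 p = c3 q -> p = q.
Proof.
destruct p as [[p1 p2] p3], q as [[q1 q2] q3]; cbn; now intros -> -> ->.
Qed.

Lemma c1_plus (p q : vec3) : c1 (plus p q) = c1 p + c1 q.
Proof. reflexivity. Qed.
Lemma c2_plus (p q : vec3) : c2 (plus p q) = c2 p + c2 q.
Proof. reflexivity. Qed.
Lemma c3_plus (p q : vec3) : c3 (plus p q) = c3 p + c3 q.
Proof. reflexivity. Qed.
Lemma c1_minus (p q : vec3) : c1 (minus p q) = c1 p - c1 q.
Proof. reflexivity. Qed.
Lemma c2_minus (p q : vec3) : c2 (minus p q) = c2 p - c2 q.
Proof. reflexivity. Qed.
Lemma c3_minus (p q : vec3) : c3 (minus p q) = c3 p - c3 q.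
Proof. reflexivity. Qed.
Lemma c1_scal (x : R) (p : vec3) : c1 (scal x p) = x * c1 p.
Proof. reflexivity. Qed.
Lemma c2_scal (x : R) (p : vec3) : c2 (scal x p) = x * c2 p.
Proof. reflexivity. Qed.
Lemma c3_scal (x : R) (p : vec3) : c3 (scal x p) = x * c3 p.
Proof. reflexivity. Qed.
Lemma c1_zero : c1 (zero : vec3) = 0.
Proof. reflexivity. Qed.
Lemma c2_zero : c2 (zero : vec3) = 0.
Proof. reflexivity. Qed.
Lemma c3_zero : c3 (zero : vec3) = 0.
Proof. reflexivity. Qed.
Lemma c1_mk (x y z : R) : c1 (x, y, z) = x.
Proof. reflexivity. Qed.
Lemma c2_mk (x y z : R) : c2 (x, y, z) = y.
Proof. reflexivity. Qed.
Lemma c3_mk (x y z : R) : c3 (x, y, z) = z.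
Proof. reflexivity. Qed.

Ltac components :=
  rewrite ?c1_plus, ?c2_plus, ?c3_plus, ?c1_minus, ?c2_minus, ?c3_minus,
    ?c1_scal, ?c2_scal, ?c3_scal, ?c1_zero, ?c2_zero, ?c3_zero,
    ?c1_mk, ?c2_mk, ?c3_mk.
Ltac vec_ring :=
  unfold comb, cross, dot; try apply vec3_eq; repeat (progress components); ring.

Lemma cross_triple (p q r : vec3) :
  cross p (cross q r) = minus (scal (dot p r) q) (scal (dot p q) r).
Proof. vec_ring. Qed.

Lemma cross_anticomm (p q : vec3) : cross p q = scal (-1) (cross q p).
Proof. vec_ring. Qed.

Lemma dot_comm (p q : vec3) : dot p q = dot q p.
Proof. vec_ring. Qed.

Lemma cross_23 (F : frame) : cross (fe2 F) (fe3 F) = fe1 F.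
Proof.
rewrite (frame_3 F), cross_triple, (dot_comm (fe2 F) (fe1 F)), frame_22, frame_12.
vec_ring.
Qed.

Lemma cross_31 (F : frame) : cross (fe3 F) (fe1 F) = fe2 F.
Proof.
rewrite cross_anticomm, (frame_3 F), cross_triple, frame_11, frame_12.
vec_ring.
Qed.

Lemma frame_13 (F : frame) : dot (fe1 F) (fe3 F) = 0.
Proof. rewrite frame_3; vec_ring. Qed.

Lemma frame_23 (F : frame) : dot (fe2 F) (fe3 F) = 0.
Proof. rewrite frame_3; vec_ring. Qed.

Lemma frame_33 (F : frame) : dot (fe3 F) (fe3 F) = 1.
Proof.
rewrite (frame_3 F) at 1.
transitivity (dot (fe1 F) (cross (fe2 F) (fe3 F))); [vec_ring|].
rewrite cross_23; apply frame_11.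
Qed.

Lemma dot_comb (F : frame) (x y z x' y' z' : R) :
  dot (comb F x y z) (comb F x' y' z') = x * x' + y * y' + z * z'.
Proof.
transitivity (x * x' * dot (fe1 F) (fe1 F) + y * y' * dot (fe2 F) (fe2 F)
  + z * z' * dot (fe3 F) (fe3 F) + (x * y' + y * x') * dot (fe1 F) (fe2 F)
  + (x * z' + z * x') * dot (fe1 F) (fe3 F) + (y * z' + z * y') * dot (fe2 F) (fe3 F)).
- vec_ring.
- rewrite frame_11, frame_22, frame_33, frame_12, frame_13, frame_23; ring.
Qed.

Lemma cross_comb (F : frame) (x y z x' y' z' : R) :
  cross (comb F x y z) (comb F x' y' z')
  = comb F (y * z' - z * y') (z * x' - x * z') (x * y' - y * x').
Proof.
transitivity (plus (scal (y * z' - z * y') (cross (fe2 F) (fe3 F)))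
  (plus (scal (z * x' - x * z') (cross (fe3 F) (fe1 F)))
        (scal (x * y' - y * x') (cross (fe1 F) (fe2 F))))).
- vec_ring.
- now rewrite cross_23, cross_31, <- frame_3.
Qed.

Lemma scal_comb (F : frame) (r x y z : R) :
  scal r (comb F x y z) = comb F (r * x) (r * y) (r * z).
Proof. vec_ring. Qed.

(** With [e3 = e1 x e2], the double cross product [e3 x (q x e3)] recovers the
    part of [q] orthogonal to [e3], and it vanishes when [q] is orthogonal to
    [e1] and [e2]. *)
Lemma axial_of_orthogonal (F : frame) (q : vec3) :
  dot q (fe1 F) = 0 -> dot q (fe2 F) = 0 -> q = scal (dot q (fe3 F)) (fe3 F).
Proof.
intros H1 H2.
assert (Hc : cross q (fe3 F) = zero).
{ rewrite (frame_3 F), cross_triple, H1, H2; vec_ring. }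
assert (H : cross (fe3 F) (cross q (fe3 F)) = zero) by (rewrite Hc; vec_ring).
rewrite cross_triple, frame_33 in H.
rewrite (dot_comm q).
transitivity (plus (minus (scal 1 q) (scal (dot (fe3 F) q) (fe3 F)))
                   (scal (dot (fe3 F) q) (fe3 F))); [vec_ring|].
rewrite H; vec_ring.
Qed.

Lemma cos2_sin2 (v : R) : cos v * cos v + sin v * sin v = 1.
Proof. generalize (sin2_cos2 v); unfold Rsqr; lra. Qed.

Lemma turn_11 (F : frame) (v : R) :
  dot (comb F (cos v) (sin v) 0) (comb F (cos v) (sin v) 0) = 1.
Proof. rewrite dot_comb; generalize (cos2_sin2 v); lra. Qed.

Lemma turn_22 (F : frame) (v : R) :
  dot (comb F (- sin v) (cos v) 0) (comb F (- sin v) (cos v) 0) = 1.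
Proof. rewrite dot_comb; generalize (cos2_sin2 v); lra. Qed.

Lemma turn_12 (F : frame) (v : R) :
  dot (comb F (cos v) (sin v) 0) (comb F (- sin v) (cos v) 0) = 0.
Proof. rewrite dot_comb; ring. Qed.

Lemma turn_3 (F : frame) (v : R) :
  fe3 F = cross (comb F (cos v) (sin v) 0) (comb F (- sin v) (cos v) 0).
Proof.
rewrite cross_comb.
transitivity (comb F 0 0 1); [vec_ring|].
f_equal; try ring; generalize (cos2_sin2 v); lra.
Qed.

Definition turn (F : frame) (v : R) : frame :=
  Frame _ _ _ (turn_11 F v) (turn_22 F v) (turn_12 F v) (turn_3 F v).

Lemma comb_turn (F : frame) (v x y z : R) :
  comb (turn F v) x y z = comb F (x * cos v - y * sin v) (x * sin v + y * cos v) z.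
Proof. unfold turn; unfold comb at 1; simpl fe1; simpl fe2; simpl fe3; vec_ring. Qed.

Lemma comb_turn_period (F : frame) (v x y z : R) :
  comb (turn F (v + 2 * PI)) x y z = comb (turn F v) x y z.
Proof.
rewrite !comb_turn, cos_plus, sin_plus, cos_2PI, sin_2PI; f_equal; ring.
Qed.

(** Every vector field met below has, in the frame turning with the angle [v],
    components depending on [u] only.  This class is stable under both partial
    derivatives: the one in [u] acts on the components and the one in [v] is a
    quarter turn about the axis. *)
Definition revolving (F : frame) (a c b : R -> R) (u v : R) : vec3 :=
  comb (turn F v) (a u) (c u) (b u).

Lemma partial_u_ext (J : R -> Prop) (h k : R -> R -> R) (u v : R) :
  open J -> (forall s t, J s -> h s t = k s t) -> J u ->
  partial cu h u v = partial cu k u v.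
Proof.
intros HJ E Ju; apply Derive_ext_loc.
apply (filter_imp J); [intros t Jt; now apply E | now apply HJ].
Qed.

Lemma partial_v_ext (J : R -> Prop) (h k : R -> R -> R) (u v : R) :
  (forall s t, J s -> h s t = k s t) -> J u -> partial cv h u v = partial cv k u v.
Proof. intros E Ju; apply Derive_ext; intros t; now apply E. Qed.

Lemma partial_ext (J : R -> Prop) (i : coord) (h k : R -> R -> R) (u v : R) :
  open J -> (forall s t, J s -> h s t = k s t) -> J u ->
  partial i h u v = partial i k u v.
Proof.
intros; destruct i; [now apply (partial_u_ext J) | now apply (partial_v_ext J)].
Qed.

Lemma vpartial_ext (J : R -> Prop) (i : coord) (Y Z : R -> R -> vec3) (u v : R) :
  open J -> (forall s t, J s -> Y s t = Z s t) -> J u ->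
  vpartial i Y u v = vpartial i Z u v.
Proof.
intros HJ E Ju; unfold vpartial.
f_equal; [f_equal|]; apply (partial_ext J); trivial; intros; now rewrite E.
Qed.

Lemma vpartial_u_revolving (J : R -> Prop) (F : frame) (p : vec3) (a c b : R -> R)
    (Y : R -> R -> vec3) (u v a' c' b' : R) :
  open J -> (forall s t, J s -> Y s t = plus p (revolving F a c b s t)) -> J u ->
  is_derive a u a' -> is_derive c u c' -> is_derive b u b' ->
  vpartial cu Y u v = comb (turn F v) a' c' b'.
Proof.
intros HJ E Ju Ha Hc Hb; rewrite (vpartial_ext J cu Y _ u v HJ E Ju).
assert (D : forall r x y z : R,
  Derive (fun t => r + (a t * x + (c t * y + b t * z))) u = a' * x + (c' * y + b' * z)).
{ intros r x y z; apply is_derive_unique; auto_derive.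
  - repeat split; eexists; eassumption.
  - change (Derive (fun x => a x) u) with (Derive a u).
    change (Derive (fun x => b x) u) with (Derive b u).
    change (Derive (fun x => c x) u) with (Derive c u).
    rewrite (is_derive_unique a u a' Ha), (is_derive_unique b u b' Hb),
      (is_derive_unique c u c' Hc); ring. }
apply vec3_eq; apply D.
Qed.

Lemma vpartial_v_revolving (J : R -> Prop) (F : frame) (p : vec3) (a c b : R -> R)
    (Y : R -> R -> vec3) (u v : R) :
  open J -> (forall s t, J s -> Y s t = plus p (revolving F a c b s t)) -> J u ->
  vpartial cv Y u v = comb (turn F v) (- c u) (a u) 0.
Proof.
intros HJ E Ju; rewrite (vpartial_ext J cv Y _ u v HJ E Ju).
rewrite comb_turn.
assert (D : forall r x y z : R,
  Derive (fun t => r + ((a u * cos t - c u * sin t) * x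
                        + ((a u * sin t + c u * cos t) * y + b u * z))) v
  = (- c u * cos v - a u * sin v) * x
    + ((- c u * sin v + a u * cos v) * y + 0 * z)).
{ intros r x y z; apply is_derive_unique; auto_derive; [trivial|]; ring. }
assert (E' : forall s t, J s -> plus p (revolving F a c b s t)
  = plus p (comb F (a s * cos t - c s * sin t) (a s * sin t + c s * cos t) (b s))).
{ intros s t _; unfold revolving; now rewrite comb_turn. }
rewrite (vpartial_ext J cv _ _ u v HJ E' Ju).
apply vec3_eq; apply D.
Qed.

(** * Smoothness of revolving fields *)

Lemma Ck_ext (n : nat) (J : R -> Prop) (h k : R -> R -> R) :
  open J -> (forall u v, J u -> h u v = k u v) -> Ck n J h -> Ck n J k.
Proof.
intros HJ; revert h k; induction n as [|n IH]; intros h k E [Hc Hd].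
- split; [|exact I].
  intros u v Ju; apply continuity_2d_pt_ext_loc with h; [|now apply Hc].
  destruct (HJ u Ju) as [d Hd']; exists d.
  intros s t Hs _; apply E, Hd', Hs.
- split; [|split].
  + intros u v Ju; apply continuity_2d_pt_ext_loc with h; [|now apply Hc].
    destruct (HJ u Ju) as [d Hd']; exists d.
    intros s t Hs _; apply E, Hd', Hs.
  + intros u v Ju; destruct Hd as [Hd _]; destruct (Hd u v Ju) as [H1 H2]; split.
    * apply ex_derive_ext_loc with (fun t => h t v); trivial.
      apply (filter_imp J); [intros t Jt; now apply E | now apply HJ].
    * apply ex_derive_ext with (fun t => h u t); trivial; intros t; now apply E.
  + intros i; apply IH with (partial i h); [|apply Hd].
    intros u v Ju; now apply (partial_ext J).
Qed.

Lemma smooth2_revolving_component (J : R -> Prop) (a c b : R -> R) (x y z : R) :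
  open J -> smooth1 J a -> smooth1 J c -> smooth1 J b ->
  smooth2 J (fun u v => (a u * cos v - c u * sin v) * x
                        + ((a u * sin v + c u * cos v) * y + b u * z)).
Proof.
intros HJ Ha Hc Hb n; revert a c b Ha Hc Hb; induction n as [|n IH]; intros a c b Ha Hc Hb.
all: assert (C : forall h, smooth1 J h -> forall u v, J u ->
  continuity_2d_pt (fun s _ => h s) u v)
  by (intros h Hh u v Ju; apply continuity_1d_2d_pt_comp;
      [ apply derivable_continuous_pt, ex_derive_Reals_0; now apply (smooth1_ex_derive J)
      | apply continuity_2d_pt_id1 ]).
all: assert (Cc : forall u v, continuity_2d_pt (fun _ t => cos t) u v)
  by (intros u v; apply (continuity_1d_2d_pt_comp cos (fun _ t => t));
      [apply continuity_cos | apply continuity_2d_pt_id2]).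
all: assert (Cs : forall u v, continuity_2d_pt (fun _ t => sin t) u v)
  by (intros u v; apply (continuity_1d_2d_pt_comp sin (fun _ t => t));
      [apply continuity_sin | apply continuity_2d_pt_id2]).
all: split.
1,3: intros u v Ju;
  repeat first [ apply continuity_2d_pt_minus | apply continuity_2d_pt_plus
               | apply continuity_2d_pt_mult ];
  auto using continuity_2d_pt_const.
- exact I.
- split.
  + intros u v Ju.
    pose proof (smooth1_ex_derive J a u Ha Ju).
    pose proof (smooth1_ex_derive J b u Hb Ju).
    pose proof (smooth1_ex_derive J c u Hc Ju).
    split; auto_derive; tauto.
  + intros [|].
    * apply (Ck_ext n J (fun u v => (Derive a u * cos v - Derive c u * sin v) * x
        + ((Derive a u * sin v + Derive c u * cos v) * y + Derive b u * z))); trivial.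
      -- intros u v Ju; symmetry; apply is_derive_unique.
         pose proof (smooth1_ex_derive J a u Ha Ju).
         pose proof (smooth1_ex_derive J b u Hb Ju).
         pose proof (smooth1_ex_derive J c u Hc Ju).
         auto_derive; [tauto|].
         change (Derive (fun x => a x) u) with (Derive a u).
         change (Derive (fun x => b x) u) with (Derive b u).
         change (Derive (fun x => c x) u) with (Derive c u); ring.
      -- apply IH; now apply smooth1_Derive.
    * apply (Ck_ext n J (fun u v => ((- c u) * cos v - a u * sin v) * x
        + (((- c u) * sin v + a u * cos v) * y + 0 * z))); trivial.
      -- intros u v Ju; symmetry; apply is_derive_unique.
         auto_derive; [trivial|]; ring.
      -- apply (IH (fun u => - c u) a (fun _ => 0)); trivial;
           [now apply smooth1_opp | now apply smooth1_const].
Qed.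

Lemma vsmooth2_revolving (J : R -> Prop) (F : frame) (a c b : R -> R) :
  open J -> smooth1 J a -> smooth1 J c -> smooth1 J b ->
  vsmooth2 J (revolving F a c b).
Proof.
intros HJ Ha Hc Hb.
assert (H : forall x y z, smooth2 J (fun u v => (a u * cos v - c u * sin v) * x
  + ((a u * sin v + c u * cos v) * y + b u * z)))
  by (intros; now apply smooth2_revolving_component).
repeat split; intros n.
- apply (Ck_ext n J _ _ HJ) with (2 := H (c1 (fe1 F)) (c1 (fe2 F)) (c1 (fe3 F)) n).
  intros; unfold revolving; now rewrite comb_turn.
- apply (Ck_ext n J _ _ HJ) with (2 := H (c2 (fe1 F)) (c2 (fe2 F)) (c2 (fe3 F)) n).
  intros; unfold revolving; now rewrite comb_turn.
- apply (Ck_ext n J _ _ HJ) with (2 := H (c3 (fe1 F)) (c3 (fe2 F)) (c3 (fe3 F)) n).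
  intros; unfold revolving; now rewrite comb_turn.
Qed.

(** * Profile curves and the curvature of the surfaces they generate *)

(** The unit tangent of the profile curve is [(tcos, tsin)], the cosine and sine of
    its angle with the [rad] direction, and [trn] is the derivative of this
    angle.  Carrying the angle through its cosine and sine avoids having to lift it
    to a function. *)
Record profile : Type := Profile {
  rad : R -> R; hgt : R -> R; spd : R -> R; tcos : R -> R; tsin : R -> R; trn : R -> R
}.

(** The radius and the speed may be negative: passing to a parallel surface may
    reverse the profile curve or push it across the axis, and both cases are then
    covered by the same formulas. *)
Record regular_profile (J : R -> Prop) (P : profile) : Prop := {
  rad_smooth : smooth1 J (rad P);
  hgt_smooth : smooth1 J (hgt P);
  spd_smooth : smooth1 J (spd P);
  tcos_smooth : smooth1 J (tcos P);
  tsin_smooth : smooth1 J (tsin P);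
  trn_smooth : smooth1 J (trn P);
  rad_derive : forall u, J u -> is_derive (rad P) u (spd P u * tcos P u);
  hgt_derive : forall u, J u -> is_derive (hgt P) u (spd P u * tsin P u);
  tcos_derive : forall u, J u -> is_derive (tcos P) u (- (trn P u * tsin P u));
  tsin_derive : forall u, J u -> is_derive (tsin P) u (trn P u * tcos P u);
  tangent_unit : forall u, J u -> tcos P u * tcos P u + tsin P u * tsin P u = 1;
  rad_neq0 : forall u, J u -> rad P u <> 0;
  spd_neq0 : forall u, J u -> spd P u <> 0
}.

(** [sg] is the sign by which the normal of the surface differs from the normal
    [(- tsin, tcos)] of the profile curve. *)
Record generated (J : R -> Prop) (F : frame) (p : vec3) (P : profile) (sg : R)
    (X : R -> R -> vec3) : Prop := {
  generated_regular : regular_profile J P;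
  generated_eq : forall u v, J u ->
    X u v = plus p (revolving F (rad P) (fun _ => 0) (hgt P) u v);
  generated_sign : sg = 1 \/ sg = -1;
  generated_oriented : forall u, J u -> 0 < sg * (rad P u * spd P u)
}.

Lemma generated_exists_sign (J : R -> Prop) (F : frame) (p : vec3) (P : profile)
    (X : R -> R -> vec3) :
  interval J -> (exists u, J u) -> regular_profile J P ->
  (forall u v, J u -> X u v = plus p (revolving F (rad P) (fun _ => 0) (hgt P) u v)) ->
  exists sg, generated J F p P sg X.
Proof.
intros HJ Hne HP E.
destruct (constant_sign J (fun u => rad P u * spd P u)) as [sg [H1 H2]]; trivial.
- intros u Ju; apply (smooth1_ex_derive J); trivial.
  apply smooth1_mult; [apply HJ | apply (rad_smooth _ _ HP) | apply (spd_smooth _ _ HP)].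
- intros u Ju; apply Rmult_integral_contrapositive_currified;
    [apply (rad_neq0 _ _ HP u Ju) | apply (spd_neq0 _ _ HP u Ju)].
- exists sg; now constructor.
Qed.

Lemma revolving_zero (F : frame) (a c b : R -> R) (u v : R) :
  revolving F a c b u v = plus zero (revolving F a c b u v).
Proof. symmetry; apply (plus_zero_l (revolving F a c b u v : prod_AbelianMonoid _ _)). Qed.

Section Generated.
Context {J : R -> Prop} (HJ : open J) {F : frame} {p : vec3} {P : profile} {sg : R}
  {X : R -> R -> vec3} (G : generated J F p P sg X).

Local Notation f := (rad P).
Local Notation w := (spd P).
Local Notation c := (tcos P).
Local Notation s := (tsin P).
Local Notation k := (trn P).

Lemma generated_sign_sqr : sg * sg = 1.
Proof. destruct (generated_sign _ _ _ _ _ _ G) as [-> | ->]; ring. Qed.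

Lemma generated_X_u (u v : R) : J u ->
  vpartial cu X u v = comb (turn F v) (w u * c u) 0 (w u * s u).
Proof.
destruct G as [HP E _ _]; intros Ju.
apply (vpartial_u_revolving J F p f (fun _ => 0) (hgt P)); trivial.
- now apply (rad_derive _ _ HP).
- apply @is_derive_const.
- now apply (hgt_derive _ _ HP).
Qed.

Lemma generated_X_v (u v : R) : J u -> vpartial cv X u v = comb (turn F v) 0 (f u) 0.
Proof.
destruct G as [HP E _ _]; intros Ju.
rewrite (vpartial_v_revolving J F p f (fun _ => 0) (hgt P)); trivial.
now rewrite Ropp_0.
Qed.

Lemma generated_normal (u v : R) : J u ->
  normal X u v
  = revolving F (fun t => - (sg * s t)) (fun _ => 0) (fun t => sg * c t) u v.
Proof.
intros Ju; unfold normal, revolving.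
rewrite generated_X_u, generated_X_v, cross_comb by trivial; cbv zeta.
pose proof (generated_oriented _ _ _ _ _ _ G u Ju) as Ho.
pose proof (tangent_unit _ _ (generated_regular _ _ _ _ _ _ G) u Ju) as Hu.
pose proof generated_sign_sqr as Hs.
assert (Hn : f u * w u <> 0) by (intros H0; rewrite H0 in Ho; lra).
unfold enorm; rewrite dot_comb.
replace (_ + _) with ((sg * (f u * w u)) * (sg * (f u * w u))).
- rewrite sqrt_square by lra; rewrite scal_comb.
  assert (Hsg : sg <> 0) by (intros H0; rewrite H0 in Ho; lra).
  assert (Hinv : / sg = sg) by (apply Rmult_eq_reg_l with sg; trivial; rewrite Hs; field; trivial).
  rewrite Rinv_mult, Hinv.
  f_equal; field; split; intros H0; apply Hn; rewrite H0; ring.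
- transitivity ((sg * sg) * ((f u * w u) * (f u * w u))); [ring|].
  transitivity ((f u * w u) * (f u * w u) * (c u * c u + s u * s u)); [|ring].
  rewrite Hs, Hu; ring.
Qed.

Lemma generated_I (i j : coord) (u v : R) : J u ->
  I_form X i j u v
  = match i, j with cu, cu => w u * w u | cv, cv => f u * f u | _, _ => 0 end.
Proof.
intros Ju; unfold I_form.
pose proof (tangent_unit _ _ (generated_regular _ _ _ _ _ _ G) u Ju) as Hu.
destruct i, j; rewrite ?generated_X_u, ?generated_X_v, dot_comb by trivial; try ring.
transitivity (w u * w u * (c u * c u + s u * s u)); [ring | rewrite Hu; ring].
Qed.

Lemma generated_II (i j : coord) (u v : R) : J u ->
  II_form X i j u v
  = match i, j with
    | cu, cu => sg * (w u * k u) | cv, cv => sg * (f u * s u) | _, _ => 0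
    end.
Proof.
intros Ju; unfold II_form; rewrite (generated_normal u v Ju).
unfold revolving.
pose proof (generated_regular _ _ _ _ _ _ G) as HP.
pose proof (tangent_unit _ _ HP u Ju) as Hu.
pose proof (smooth1_is_derive J w u (spd_smooth _ _ HP) Ju) as Dw.
pose proof (tcos_derive _ _ HP u Ju) as Dc.
pose proof (tsin_derive _ _ HP u Ju) as Ds.
assert (Eu : forall s' t, J s' -> vpartial cu X s' t
  = plus zero (revolving F (fun u => w u * c u) (fun _ => 0) (fun u => w u * s u) s' t)).
{ intros s' t Js; rewrite <- revolving_zero; now apply generated_X_u. }
assert (Ev : forall s' t, J s' -> vpartial cv X s' t
  = plus zero (revolving F (fun _ => 0) f (fun _ => 0) s' t)).
{ intros s' t Js; rewrite <- revolving_zero; now apply generated_X_v. }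
destruct i, j.
- rewrite (vpartial_u_revolving J F zero _ _ _ _ u v
    (Derive w u * c u + w u * - (k u * s u)) 0
    (Derive w u * s u + w u * (k u * c u)) HJ Eu Ju), dot_comb.
  + transitivity (sg * (w u * k u) * (c u * c u + s u * s u)); [ring | rewrite Hu; ring].
  + apply (is_derive_mult w c); trivial; intros; apply Rmult_comm.
  + apply @is_derive_const.
  + apply (is_derive_mult w s); trivial; intros; apply Rmult_comm.
- rewrite (vpartial_u_revolving J F zero _ _ _ _ u v 0 (w u * c u) 0 HJ Ev Ju), dot_comb.
  + ring.
  + apply @is_derive_const.
  + now apply (rad_derive _ _ HP).
  + apply @is_derive_const.
- rewrite (vpartial_v_revolving J F zero _ _ _ _ u v HJ Eu Ju), dot_comb; ring.
- rewrite (vpartial_v_revolving J F zero _ _ _ _ u v HJ Ev Ju), dot_comb; ring.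
Qed.

Lemma generated_gauss_curvature (u v : R) : J u ->
  gauss_curvature X u v = (k u / w u) * (s u / f u).
Proof.
intros Ju; unfold gauss_curvature, det2; rewrite !generated_I, !generated_II by trivial.
pose proof (generated_regular _ _ _ _ _ _ G) as HP.
pose proof (rad_neq0 _ _ HP u Ju); pose proof (spd_neq0 _ _ HP u Ju).
transitivity ((sg * sg) * ((k u / w u) * (s u / f u))).
- field; auto.
- rewrite generated_sign_sqr; ring.
Qed.

Lemma generated_mean_curvature (u v : R) : J u ->
  mean_curvature X u v = sg / 2 * (k u / w u + s u / f u).
Proof.
intros Ju; unfold mean_curvature, inv2, sum2, det2.
rewrite !generated_I, !generated_II by trivial.
pose proof (generated_regular _ _ _ _ _ _ G) as HP.
pose proof (rad_neq0 _ _ HP u Ju); pose proof (spd_neq0 _ _ HP u Ju).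
field; auto.
Qed.

Lemma generated_curvature_neq0 (u v : R) : J u ->
  gauss_curvature X u v <> 0 <-> k u <> 0 /\ s u <> 0.
Proof.
intros Ju; rewrite (generated_gauss_curvature u v Ju).
pose proof (generated_regular _ _ _ _ _ _ G) as HP.
pose proof (rad_neq0 _ _ HP u Ju); pose proof (spd_neq0 _ _ HP u Ju).
unfold Rdiv; split.
- intros H1; split; intros H2; apply H1; rewrite H2; ring.
- intros [H1 H2]; repeat apply Rmult_integral_contrapositive_currified;
    auto using Rinv_neq_0_compat.
Qed.

Lemma generated_sum_radii (u v : R) : J u -> k u <> 0 -> s u <> 0 ->
  sum_radii X u v = sg * (w u / k u + f u / s u).
Proof.
intros Ju Hk Hs; unfold sum_radii.
rewrite generated_mean_curvature, generated_gauss_curvature by trivial.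
pose proof (generated_regular _ _ _ _ _ _ G) as HP.
pose proof (rad_neq0 _ _ HP u Ju); pose proof (spd_neq0 _ _ HP u Ju).
field; auto.
Qed.

(** The third fundamental form only sees the normal, hence neither the radius nor
    the speed: it is the same for all parallel surfaces. *)
Lemma generated_III (i j : coord) (u v : R) : J u ->
  III_form X i j u v
  = match i, j with cu, cu => k u * k u | cv, cv => s u * s u | _, _ => 0 end.
Proof.
intros Ju; unfold III_form.
pose proof (generated_regular _ _ _ _ _ _ G) as HP.
pose proof (tangent_unit _ _ HP u Ju) as Hu.
assert (E : forall s' t, J s' -> normal X s' t
  = plus zero (revolving F (fun u => - (sg * s u)) (fun _ => 0) (fun u => sg * c u) s' t)).
{ intros s' t Js; rewrite <- revolving_zero; now apply generated_normal. }
assert (Eu : vpartial cu (normal X) u v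
  = comb (turn F v) (- (sg * (k u * c u))) 0 (sg * - (k u * s u))).
{ apply (vpartial_u_revolving J F zero _ _ _ _ u v _ _ _ HJ E Ju).
  - apply (is_derive_opp (fun u => sg * s u)), (is_derive_scal s).
    now apply (tsin_derive _ _ HP).
  - apply @is_derive_const.
  - apply (is_derive_scal c); now apply (tcos_derive _ _ HP). }
assert (Ev := vpartial_v_revolving J F zero _ _ _ _ u v HJ E Ju).
destruct i, j; rewrite ?Eu, ?Ev, dot_comb; try ring.
- transitivity ((sg * sg) * (k u * k u) * (c u * c u + s u * s u)); [ring|].
  rewrite Hu, generated_sign_sqr; ring.
- transitivity ((sg * sg) * (s u * s u)); [ring | rewrite generated_sign_sqr; ring].
Qed.

Lemma generated_III_u (i j : coord) (u v : R) : J u ->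
  partial cu (III_form X i j) u v
  = match i, j with
    | cu, cu => 2 * k u * Derive k u | cv, cv => 2 * s u * (k u * c u) | _, _ => 0
    end.
Proof.
intros Ju.
pose proof (generated_regular _ _ _ _ _ _ G) as HP.
rewrite (partial_u_ext J _ _ u v HJ (generated_III i j) Ju).
apply is_derive_unique; destruct i, j; try apply @is_derive_const.
- pose proof (smooth1_ex_derive J k u (trn_smooth _ _ HP) Ju).
  auto_derive; [tauto|].
  change (Derive (fun x => trn P x) u) with (Derive k u); ring.
- pose proof (tsin_derive _ _ HP u Ju) as Ds.
  assert (ex_derive s u) by (eexists; exact Ds).
  auto_derive; [tauto|].
  change (Derive (fun x => tsin P x) u) with (Derive s u).
  rewrite (is_derive_unique s u _ Ds); ring.
Qed.

Lemma generated_III_v (i j : coord) (u v : R) : J u ->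
  partial cv (III_form X i j) u v = 0.
Proof.
intros Ju; rewrite (partial_v_ext J _ _ u v (generated_III i j) Ju).
unfold partial; apply Derive_const.
Qed.

Lemma generated_III_laplacian (h : R -> R -> R) (u v : R) : J u -> k u <> 0 -> s u <> 0 ->
  III_laplacian X h u v
  = - ((partial cu (partial cu h) u v - Derive k u / k u * partial cu h u v) / (k u * k u)
       + (partial cv (partial cv h) u v + s u * c u / k u * partial cu h u v) / (s u * s u)).
Proof.
intros Ju Hk Hs.
unfold III_laplacian, III_christoffel, III_inv, inv2, sum2, det2.
rewrite !generated_III_u, !generated_III_v, !generated_III by trivial.
field; auto.
Qed.

(** With the tangent angle in place of [u] as a coordinate, [III] is the metric of
    the unit sphere and the Laplacian involves neither [k] nor its derivative.  This
    is why the derivatives are given with respect to the angle: [a' = k al] and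
    [al' = k al2], and likewise for [b]. *)
Lemma generated_III_vlaplacian (Y : R -> R -> vec3) (a b al be al2 be2 : R -> R) (u v : R) :
  (forall u v, J u -> Y u v = revolving F a (fun _ => 0) b u v) ->
  (forall u, J u -> is_derive a u (k u * al u)) ->
  (forall u, J u -> is_derive b u (k u * be u)) ->
  (forall u, J u -> is_derive al u (k u * al2 u)) ->
  (forall u, J u -> is_derive be u (k u * be2 u)) ->
  J u -> k u <> 0 -> s u <> 0 ->
  III_vlaplacian X Y u v
  = comb (turn F v) (- (al2 u - a u / (s u * s u) + c u * al u / s u)) 0
      (- (be2 u + c u * be u / s u)).
Proof.
intros E Da Db Dal Dbe Ju Hk Hs.
pose proof (generated_regular _ _ _ _ _ _ G) as HP.
pose proof (smooth1_is_derive J k u (trn_smooth _ _ HP) Ju) as Dk.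
assert (E0 : forall s' t, J s' -> Y s' t = plus zero (revolving F a (fun _ => 0) b s' t)).
{ intros s' t Js; rewrite <- revolving_zero; now apply E. }
assert (Eu : forall s' t, J s' -> vpartial cu Y s' t = plus zero (revolving F
  (fun u => k u * al u) (fun _ => 0) (fun u => k u * be u) s' t)).
{ intros s' t Js; rewrite <- revolving_zero.
  apply (vpartial_u_revolving J F zero _ _ _ _ s' t _ _ _ HJ E0 Js); auto.
  apply @is_derive_const. }
assert (Ev : forall s' t, J s' -> vpartial cv Y s' t = plus zero (revolving F
  (fun _ => - 0) a (fun _ => 0) s' t)).
{ intros s' t Js; rewrite <- revolving_zero.
  apply (vpartial_v_revolving J F zero _ _ _ _ s' t HJ E0 Js). }
assert (Euu : vpartial cu (vpartial cu Y) u v = comb (turn F v)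
  (Derive k u * al u + k u * (k u * al2 u)) 0 (Derive k u * be u + k u * (k u * be2 u))).
{ apply (vpartial_u_revolving J F zero _ _ _ _ u v _ _ _ HJ Eu Ju).
  - apply (is_derive_mult k al); auto; intros; apply Rmult_comm.
  - apply @is_derive_const.
  - apply (is_derive_mult k be); auto; intros; apply Rmult_comm. }
assert (Evv := vpartial_v_revolving J F zero _ _ _ _ u v HJ Ev Ju).
specialize (Eu u v Ju); rewrite <- revolving_zero in Eu.
assert (L : forall (pr : vec3 -> R) h, pr (vpartial cu (vpartial cu Y) u v)
    = partial cu (partial cu h) u v ->
    pr (vpartial cu Y u v) = partial cu h u v ->
    pr (vpartial cv (vpartial cv Y) u v) = partial cv (partial cv h) u v ->
  III_laplacian X h u v
  = - ((pr (vpartial cu (vpartial cu Y) u v) - Derive k u / k u * pr (vpartial cu Y u v))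
         / (k u * k u)
       + (pr (vpartial cv (vpartial cv Y) u v) + s u * c u / k u * pr (vpartial cu Y u v))
         / (s u * s u))).
{ intros pr h -> -> ->; now apply generated_III_laplacian. }
unfold III_vlaplacian.
rewrite (L c1 _ eq_refl eq_refl eq_refl), (L c2 _ eq_refl eq_refl eq_refl),
  (L c3 _ eq_refl eq_refl eq_refl), Euu, Eu, Evv.
unfold revolving, comb.
apply vec3_eq; repeat (progress components); field; auto.
Qed.

End Generated.

(** * Surfaces of revolution as generated surfaces *)

Lemma rigid_motion_frame (T : vec3 -> vec3) : rigid_motion T ->
  exists (F : frame) (p : vec3), forall q, T q = plus p (comb F (c1 q) (c2 q) (c3 q)).
Proof.
intros [e1 [e2 [e3 [b [H1 [H2 [H3 [H4 H]]]]]]]].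
now exists (Frame e1 e2 e3 H1 H2 H3 H4), b.
Qed.

Lemma frame_rigid_motion (F : frame) (p : vec3) :
  rigid_motion (fun q => plus p (comb F (c1 q) (c2 q) (c3 q))).
Proof.
exists (fe1 F), (fe2 F), (fe3 F), p.
repeat split; [apply frame_11 | apply frame_22 | apply frame_12 | apply frame_3].
Qed.

Lemma surface_of_revolution_generated (J : R -> Prop) (X : R -> R -> vec3) :
  open J -> surface_of_revolution J X -> exists F p P, generated J F p P 1 X.
Proof.
intros HJ [T [f [g [HT [Sf [Sg [Hf [Hr HX]]]]]]]].
destruct (rigid_motion_frame T HT) as [F [p E]].
set (f' := Derive f); set (g' := Derive g).
set (w2 := fun u => f' u * f' u + g' u * g' u).
set (w := fun u => sqrt (w2 u)).
assert (Sf' : smooth1 J f') by now apply smooth1_Derive.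
assert (Sg' : smooth1 J g') by now apply smooth1_Derive.
assert (Sf'' : smooth1 J (Derive f')) by now apply smooth1_Derive.
assert (Sg'' : smooth1 J (Derive g')) by now apply smooth1_Derive.
assert (Hw2 : forall u, J u -> 0 < w2 u).
{ intros u Ju; destruct (Hr u Ju) as [H|H]; apply Rsqr_pos_lt in H; unfold Rsqr in H;
    unfold w2, f', g'; [generalize (Rle_0_sqr (Derive g u)) | generalize (Rle_0_sqr (Derive f u))];
    unfold Rsqr; lra. }
assert (Hw : forall u, J u -> 0 < w u) by (intros u Ju; apply sqrt_lt_R0; auto).
assert (Hww : forall u, J u -> w u * w u = w2 u)
  by (intros u Ju; apply sqrt_sqrt; specialize (Hw2 u Ju); lra).
assert (Hw0 : forall u, J u -> w u <> 0) by (intros u Ju; specialize (Hw u Ju); lra).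
assert (Hw20 : forall u, J u -> w2 u <> 0) by (intros u Ju; specialize (Hw2 u Ju); lra).
assert (Sw2 : smooth1 J w2) by (apply smooth1_plus; trivial; now apply smooth1_mult).
assert (Sw : smooth1 J w) by now apply smooth1_sqrt.
assert (Dw : forall u, J u -> is_derive w u ((f' u * Derive f' u + g' u * Derive g' u) / w u)).
{ intros u Ju.
  pose proof (smooth1_ex_derive J f' u Sf' Ju).
  pose proof (smooth1_ex_derive J g' u Sg' Ju).
  unfold w, w2; auto_derive; [repeat split; trivial; exact (Hw2 u Ju)|].
  change (Derive (fun x => f' x) u) with (Derive f' u).
  change (Derive (fun x => g' x) u) with (Derive g' u).
  change (sqrt (f' u * f' u + g' u * g' u)) with (w u).
  field; auto. }
exists F, p, (Profile f g w (fun u => f' u / w u) (fun u => g' u / w u)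
  (fun u => (f' u * Derive g' u - Derive f' u * g' u) / w2 u)).
constructor; simpl; [constructor; simpl | | now left | ].
- trivial.
- trivial.
- trivial.
- now apply smooth1_div.
- now apply smooth1_div.
- apply smooth1_div; trivial; apply smooth1_minus; trivial; now apply smooth1_mult.
- intros u Ju; replace (w u * (f' u / w u)) with (Derive f u) by (unfold f'; field; auto).
  now apply (smooth1_is_derive J f u Sf).
- intros u Ju; replace (w u * (g' u / w u)) with (Derive g u) by (unfold g'; field; auto).
  now apply (smooth1_is_derive J g u Sg).
- intros u Ju.
  replace (- _) with ((Derive f' u * w u
    - f' u * ((f' u * Derive f' u + g' u * Derive g' u) / w u)) / (w u) ^ 2).
  + apply (is_derive_div f' w); auto; now apply (smooth1_is_derive J f' u Sf').
  + rewrite <- (Hww u Ju).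
    transitivity ((Derive f' u * (w u * w u) - (f' u * Derive f' u + g' u * Derive g' u) * f' u)
      / (w u * w u * w u)); [field; auto|].
    rewrite (Hww u Ju) at 1; unfold w2; field; auto.
- intros u Ju.
  replace (_ / w2 u * _) with ((Derive g' u * w u
    - g' u * ((f' u * Derive f' u + g' u * Derive g' u) / w u)) / (w u) ^ 2).
  + apply (is_derive_div g' w); auto; now apply (smooth1_is_derive J g' u Sg').
  + rewrite <- (Hww u Ju).
    transitivity ((Derive g' u * (w u * w u) - (f' u * Derive f' u + g' u * Derive g' u) * g' u)
      / (w u * w u * w u)); [field; auto|].
    rewrite (Hww u Ju) at 1; unfold w2; field; auto.
- intros u Ju; transitivity (w2 u / (w u * w u)); [unfold w2; field; auto|].
  rewrite Hww by trivial; field; auto.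
- intros u Ju; specialize (Hf u Ju); lra.
- trivial.
- intros u v Ju; rewrite HX, E by trivial.
  unfold revolving; rewrite comb_turn, c1_mk, c2_mk, c3_mk; do 2 f_equal; ring.
- intros u Ju; rewrite Rmult_1_l; apply Rmult_lt_0_compat; auto.
Qed.

(** A profile curve on the negative side of the axis becomes admissible after half
    a turn of the frame about the axis. *)
Lemma generated_surface_of_revolution (J : R -> Prop) (F : frame) (p : vec3)
    (P : profile) (sg : R) (X : R -> R -> vec3) :
  interval J -> (exists u, J u) -> generated J F p P sg X -> surface_of_revolution J X.
Proof.
intros HJ Hne [HP E _ _].
destruct (constant_sign J (rad P)) as [e [He Hpos]]; trivial.
- intros u Ju; apply (smooth1_ex_derive J); trivial; apply (rad_smooth _ _ HP).
- apply (rad_neq0 _ _ HP).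
- assert (exists F' : frame, forall x y z, comb F' x y z = comb F (e * x) (e * y) z)
    as [F' EF].
  { destruct He as [-> | ->].
    - exists F; intros; f_equal; ring.
    - exists (turn F PI); intros; rewrite comb_turn, cos_PI, sin_PI; f_equal; ring. }
  exists (fun q => plus p (comb F' (c1 q) (c2 q) (c3 q))), (fun u => e * rad P u), (hgt P).
  split; [apply frame_rigid_motion|].
  split; [apply smooth1_scal; [apply HJ | apply (rad_smooth _ _ HP)]|].
  split; [apply (hgt_smooth _ _ HP)|].
  split; [exact Hpos|].
  split.
  + intros u Ju.
    pose proof (tangent_unit _ _ HP u Ju) as Hu.
    pose proof (spd_neq0 _ _ HP u Ju) as Hw.
    rewrite (is_derive_unique _ _ _ (is_derive_scal _ _ e _ (rad_derive _ _ HP u Ju))).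
    rewrite (is_derive_unique _ _ _ (hgt_derive _ _ HP u Ju)).
    assert (e <> 0) by (destruct He; lra).
    destruct (Req_dec (tsin P u) 0) as [Hs|Hs].
    * left; assert (tcos P u <> 0) by (intros Hc; rewrite Hs, Hc in Hu; lra).
      now repeat apply Rmult_integral_contrapositive_currified.
    * right; now apply Rmult_integral_contrapositive_currified.
  + intros u v Ju; rewrite E, EF, c1_mk, c2_mk, c3_mk by trivial.
    unfold revolving; rewrite comb_turn.
    assert (e * e = 1) by (destruct He as [-> | ->]; ring).
    f_equal; f_equal; rewrite <- !Rmult_assoc, H; ring.
Qed.

Lemma rotation_invariant_linear (x y d : R) :
  (forall v, x * cos v + y * sin v = d) -> x = 0 /\ y = 0.
Proof.
intros H.
pose proof (H 0) as H0; pose proof (H PI) as H1; pose proof (H (PI / 2)) as H2.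
rewrite cos_0, sin_0 in H0; rewrite cos_PI, sin_PI in H1; rewrite cos_PI2, sin_PI2 in H2.
lra.
Qed.

Lemma dot_revolving (F : frame) (q : vec3) (a b : R -> R) (u v : R) :
  dot q (revolving F a (fun _ => 0) b u v)
  = a u * (dot q (fe1 F) * cos v + dot q (fe2 F) * sin v) + b u * dot q (fe3 F).
Proof. unfold revolving; rewrite comb_turn; vec_ring. Qed.

Lemma dot_plus (p q r : vec3) : dot p (plus q r) = dot p q + dot p r.
Proof. vec_ring. Qed.

Lemma generated_planar (J : R -> Prop) (F : frame) (p : vec3) (P : profile) (sg : R)
    (X : R -> R -> vec3) :
  interval J -> (exists u, J u) -> generated J F p P sg X ->
  planar J X <-> forall u, J u -> tsin P u = 0.
Proof.
intros HJ [u0 Ju0] [HP E _ _]; split.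
- intros [n [d [Hn Hd]]].
  assert (H : forall u, J u -> (dot n (fe1 F) = 0 /\ dot n (fe2 F) = 0)
    /\ hgt P u * dot n (fe3 F) = d - dot n p).
  { intros u Ju.
    assert (H : forall v, rad P u * dot n (fe1 F) * cos v + rad P u * dot n (fe2 F) * sin v
      = d - dot n p - hgt P u * dot n (fe3 F)).
    { intros v; specialize (Hd u v Ju); rewrite E, dot_plus, dot_revolving in Hd by trivial.
      rewrite <- Hd; ring. }
    destruct (rotation_invariant_linear _ _ _ H) as [H1 H2].
    pose proof (rad_neq0 _ _ HP u Ju) as Hf.
    apply Rmult_integral in H1; apply Rmult_integral in H2.
    assert (D1 : dot n (fe1 F) = 0) by tauto.
    assert (D2 : dot n (fe2 F) = 0) by tauto.
    split; [tauto|]; specialize (H 0); rewrite D1, D2 in H; lra. }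
  assert (H3 : dot n (fe3 F) <> 0).
  { intros H3; apply Hn; destruct (H u0 Ju0) as [[H1 H2] _].
    rewrite (axial_of_orthogonal F n H1 H2), H3; vec_ring. }
  intros u Ju.
  assert (D : is_derive (hgt P) u 0).
  { apply is_derive_ext_loc with (fun _ => (d - dot n p) / dot n (fe3 F));
      [|apply @is_derive_const].
    apply (filter_imp J); [|now apply HJ].
    intros t Jt; destruct (H t Jt) as [_ Ht]; rewrite <- Ht.
    change (@eq R (hgt P t * dot n (fe3 F) / dot n (fe3 F)) (hgt P t)); field; trivial. }
  apply is_derive_unique in D.
  rewrite (is_derive_unique _ _ _ (hgt_derive _ _ HP u Ju)) in D.
  apply Rmult_integral in D; pose proof (spd_neq0 _ _ HP u Ju); tauto.
- intros Hs.
  assert (Hg : forall u, J u -> hgt P u = hgt P u0).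
  { intros u Ju; apply (constant_of_derive_zero J (hgt P) HJ); trivial.
    intros t Jt; pose proof (hgt_derive _ _ HP t Jt) as D.
    now rewrite (Hs t Jt), Rmult_0_r in D. }
  exists (fe3 F), (dot (fe3 F) p + hgt P u0); split.
  + intros H; pose proof (frame_33 F) as H3; rewrite H in H3.
    revert H3; unfold dot; components; lra.
  + intros u v Ju; rewrite E, dot_plus, dot_revolving, Hg by trivial.
    rewrite !(dot_comm (fe3 F)), frame_13, frame_23, !(dot_comm p), frame_33; ring.
Qed.

(** * Parallel surfaces *)

Definition parallel_profile (P : profile) (m : R) : profile :=
  Profile (fun u => rad P u - m * tsin P u) (fun u => hgt P u + m * tcos P u)
          (fun u => spd P u - m * trn P u) (tcos P) (tsin P) (trn P).

Lemma regular_parallel_profile (J : R -> Prop) (P : profile) (m : R) :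
  open J -> regular_profile J P ->
  (forall u, J u -> rad P u - m * tsin P u <> 0) ->
  (forall u, J u -> spd P u - m * trn P u <> 0) ->
  regular_profile J (parallel_profile P m).
Proof.
intros HJ [] Hf Hw; constructor; simpl; trivial.
- apply smooth1_minus; trivial; now apply smooth1_scal.
- apply smooth1_plus; trivial; now apply smooth1_scal.
- apply smooth1_minus; trivial; now apply smooth1_scal.
- intros u Ju.
  replace (_ * _) with (spd P u * tcos P u - m * (trn P u * tcos P u)) by ring.
  apply @is_derive_minus; auto; apply is_derive_scal; auto.
- intros u Ju.
  replace (_ * _) with (spd P u * tsin P u + m * - (trn P u * tsin P u)) by ring.
  apply @is_derive_plus; auto; apply is_derive_scal; auto.
Qed.

Lemma plus_revolving_parallel (F : frame) (p : vec3) (P : profile) (m sg u v : R) :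
  plus (plus p (revolving F (rad P) (fun _ => 0) (hgt P) u v))
    (scal m (revolving F (fun t => - (sg * tsin P t)) (fun _ => 0) (fun t => sg * tcos P t) u v))
  = plus p (revolving F (rad (parallel_profile P (m * sg))) (fun _ => 0)
      (hgt (parallel_profile P (m * sg))) u v).
Proof. unfold revolving, parallel_profile; simpl; vec_ring. Qed.

(** * The three families in terms of profiles *)

(** For a minimal profile [rad * tsin] is constant; this constant is nonzero as the
    surface is not planar. *)
Lemma catenoid_generated (J : R -> Prop) (Y : R -> R -> vec3) :
  interval J -> (exists u, J u) -> catenoid J Y ->
  exists F p P, generated J F p P 1 Y /\
    forall u, J u -> trn P u <> 0 /\ tsin P u <> 0 /\
      rad P u * trn P u + spd P u * tsin P u = 0.
Proof.
intros HJ Hne [HS [Hm Hp]].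
destruct (surface_of_revolution_generated J Y (proj1 HJ) HS) as [F [p [P G]]].
exists F, p, P; split; trivial.
rewrite (generated_planar J F p P 1 Y HJ Hne G) in Hp.
pose proof (generated_regular _ _ _ _ _ _ G) as HP.
assert (Hrel : forall u, J u -> rad P u * trn P u + spd P u * tsin P u = 0).
{ intros u Ju; specialize (Hm u 0 Ju).
  rewrite (generated_mean_curvature (proj1 HJ) G) in Hm by trivial.
  pose proof (rad_neq0 _ _ HP u Ju); pose proof (spd_neq0 _ _ HP u Ju).
  transitivity (2 * (rad P u * spd P u)
    * (1 / 2 * (trn P u / spd P u + tsin P u / rad P u))); [field; auto|].
  rewrite Hm; ring. }
assert (Hc : forall u t, J u -> J t -> rad P u * tsin P u = rad P t * tsin P t).
{ apply (constant_of_derive_zero J (fun u => rad P u * tsin P u) HJ).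
  intros u Ju.
  replace 0 with (spd P u * tcos P u * tsin P u + rad P u * (trn P u * tcos P u)).
  - apply (is_derive_mult (rad P) (tsin P));
      [now apply (rad_derive _ _ HP) | now apply (tsin_derive _ _ HP)
      | intros; apply Rmult_comm].
  - transitivity (tcos P u * (rad P u * trn P u + spd P u * tsin P u)); [ring|].
    rewrite Hrel by trivial; ring. }
assert (Hs : forall u, J u -> tsin P u <> 0).
{ intros u Ju Hs; apply Hp; intros t Jt.
  specialize (Hc t u Jt Ju); rewrite Hs, Rmult_0_r in Hc.
  apply Rmult_integral in Hc; pose proof (rad_neq0 _ _ HP t Jt); tauto. }
intros u Ju; split; [|auto].
intros Hk; specialize (Hrel u Ju); rewrite Hk in Hrel.
apply (Rmult_integral_contrapositive_currified (spd P u) (tsin P u)); auto.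
- now apply (spd_neq0 _ _ HP).
- lra.
Qed.

Lemma generated_catenoid (J : R -> Prop) (F : frame) (p : vec3) (P : profile) (sg : R)
    (Y : R -> R -> vec3) :
  interval J -> (exists u, J u) -> generated J F p P sg Y ->
  (forall u, J u -> tsin P u <> 0) ->
  (forall u, J u -> rad P u * trn P u + spd P u * tsin P u = 0) ->
  catenoid J Y.
Proof.
intros HJ Hne G Hs Hrel; split; [|split].
- now apply (generated_surface_of_revolution J F p P sg).
- intros u v Ju; rewrite (generated_mean_curvature (proj1 HJ) G) by trivial.
  pose proof (generated_regular _ _ _ _ _ _ G) as HP.
  pose proof (rad_neq0 _ _ HP u Ju); pose proof (spd_neq0 _ _ HP u Ju).
  transitivity (sg / 2 * ((rad P u * trn P u + spd P u * tsin P u) / (rad P u * spd P u)));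
    [field; auto|].
  rewrite Hrel by trivial; unfold Rdiv; ring.
- rewrite (generated_planar J F p P sg Y HJ Hne G).
  destruct Hne as [u Ju]; intros H; exact (Hs u Ju (H u Ju)).
Qed.

(** The centre must lie on the axis, by rotational symmetry, so the profile curve
    lies on a circle about a point of the axis.  The number [t] is the component
    along [(tsin, - tcos)] of the vector from this point to the curve; it is constant
    because that vector has no tangential component. *)
Lemma spherical_generated (J : R -> Prop) (X : R -> R -> vec3) :
  interval J -> (exists u, J u) -> spherical J X ->
  exists F p P t q, generated J F p P 1 X /\ t <> 0 /\
    forall u, J u -> trn P u <> 0 /\ tsin P u <> 0 /\
      rad P u = t * tsin P u /\ spd P u = t * trn P u /\ hgt P u = q - t * tcos P u.
Proof.
intros HJ [u0 Ju0] [HS [ctr [r [Hr HX]]]].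
destruct (surface_of_revolution_generated J X (proj1 HJ) HS) as [F [p [P G]]].
destruct G as [HP E Hsg Hor].
set (d := minus p ctr); set (q := dot d (fe3 F)).
assert (Hdot : forall u v, J u ->
  dot d d + 2 * (rad P u * (dot d (fe1 F) * cos v + dot d (fe2 F) * sin v) + hgt P u * q)
  + (rad P u * rad P u + hgt P u * hgt P u) = r * r).
{ intros u v Ju; specialize (HX u v Ju).
  assert (Hd : minus (X u v) ctr = plus d (revolving F (rad P) (fun _ => 0) (hgt P) u v))
    by (rewrite E by trivial; unfold d; vec_ring).
  rewrite Hd in HX; unfold enorm in HX.
  set (V := revolving F (rad P) (fun _ => 0) (hgt P) u v) in *.
  assert (HV : dot V V = rad P u * rad P u + hgt P u * hgt P u)
    by (unfold V, revolving; rewrite dot_comb; ring).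
  rewrite <- HV; unfold q; rewrite <- dot_revolving; fold V.
  transitivity (dot (plus d V) (plus d V)); [vec_ring|].
  rewrite <- HX, sqrt_sqrt; trivial.
  unfold dot; generalize (Rle_0_sqr (c1 (plus d V))), (Rle_0_sqr (c2 (plus d V))),
    (Rle_0_sqr (c3 (plus d V))); unfold Rsqr; lra. }
assert (D12 : dot d (fe1 F) = 0 /\ dot d (fe2 F) = 0).
{ pose proof (rad_neq0 _ _ HP u0 Ju0) as Hf.
  destruct (rotation_invariant_linear (rad P u0 * dot d (fe1 F)) (rad P u0 * dot d (fe2 F))
    ((r * r - (rad P u0 * rad P u0 + hgt P u0 * hgt P u0) - dot d d) / 2 - hgt P u0 * q))
    as [H1 H2].
  - intros v; rewrite <- (Hdot u0 v Ju0); field.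
  - apply Rmult_integral in H1; apply Rmult_integral in H2; tauto. }
destruct D12 as [D1 D2].
assert (Hq : dot d d = q * q).
{ rewrite (axial_of_orthogonal F d D1 D2); fold q.
  transitivity (q * q * dot (fe3 F) (fe3 F)); [vec_ring | rewrite frame_33; ring]. }
assert (Hcirc : forall u, J u ->
  rad P u * rad P u + (hgt P u + q) * (hgt P u + q) = r * r).
{ intros u Ju; rewrite <- (Hdot u 0 Ju), Hq, D1, D2; ring. }
assert (Htan : forall u, J u -> rad P u * tcos P u + (hgt P u + q) * tsin P u = 0).
{ intros u Ju.
  assert (D : is_derive (fun u => rad P u * rad P u + (hgt P u + q) * (hgt P u + q)) u
    (2 * spd P u * (rad P u * tcos P u + (hgt P u + q) * tsin P u))).
  { pose proof (rad_derive _ _ HP u Ju) as Df; pose proof (hgt_derive _ _ HP u Ju) as Dg.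
    assert (ex_derive (rad P) u) by (eexists; exact Df).
    assert (ex_derive (hgt P) u) by (eexists; exact Dg).
    auto_derive; [tauto|].
    change (Derive (fun x => rad P x) u) with (Derive (rad P) u).
    change (Derive (fun x => hgt P x) u) with (Derive (hgt P) u).
    rewrite (is_derive_unique _ _ _ Df), (is_derive_unique _ _ _ Dg); ring. }
  apply is_derive_unique in D.
  rewrite (Derive_ext_loc _ (fun _ => r * r)), Derive_const in D.
  - symmetry in D; apply Rmult_integral in D; pose proof (spd_neq0 _ _ HP u Ju).
    destruct D as [D|D]; [|exact D]; lra.
  - apply (filter_imp J); [exact Hcirc | now apply HJ]. }
set (t := fun u => rad P u * tsin P u - (hgt P u + q) * tcos P u).
assert (Dt : forall u, J u -> is_derive t u 0).
{ intros u Ju.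
  pose proof (rad_derive _ _ HP u Ju) as Df; pose proof (hgt_derive _ _ HP u Ju) as Dg.
  pose proof (tcos_derive _ _ HP u Ju) as Dc; pose proof (tsin_derive _ _ HP u Ju) as Ds.
  assert (ex_derive (rad P) u) by (eexists; exact Df).
  assert (ex_derive (hgt P) u) by (eexists; exact Dg).
  assert (ex_derive (tcos P) u) by (eexists; exact Dc).
  assert (ex_derive (tsin P) u) by (eexists; exact Ds).
  unfold t; auto_derive; [tauto|].
  change (Derive (fun x => rad P x) u) with (Derive (rad P) u).
  change (Derive (fun x => hgt P x) u) with (Derive (hgt P) u).
  change (Derive (fun x => tcos P x) u) with (Derive (tcos P) u).
  change (Derive (fun x => tsin P x) u) with (Derive (tsin P) u).
  rewrite (is_derive_unique _ _ _ Df), (is_derive_unique _ _ _ Dg),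
    (is_derive_unique _ _ _ Dc), (is_derive_unique _ _ _ Ds).
  transitivity (trn P u * (rad P u * tcos P u + (hgt P u + q) * tsin P u)); [ring|].
  rewrite Htan by trivial; ring. }
assert (Ht : forall u, J u -> t u = t u0)
  by (intros; now apply (constant_of_derive_zero J t HJ)).
assert (Hf : forall u, J u -> rad P u = t u0 * tsin P u).
{ intros u Ju; rewrite <- (Ht u Ju); unfold t.
  pose proof (tangent_unit _ _ HP u Ju) as Hu; pose proof (Htan u Ju) as H.
  transitivity (rad P u * (tcos P u * tcos P u + tsin P u * tsin P u)
    - tcos P u * (rad P u * tcos P u + (hgt P u + q) * tsin P u)); [|ring].
  rewrite Hu, H; ring. }
assert (Hg : forall u, J u -> hgt P u = - q - t u0 * tcos P u).
{ intros u Ju; rewrite <- (Ht u Ju); unfold t.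
  pose proof (tangent_unit _ _ HP u Ju) as Hu; pose proof (Htan u Ju) as H.
  transitivity ((hgt P u + q) * (tcos P u * tcos P u + tsin P u * tsin P u) - q
    - tsin P u * (rad P u * tcos P u + (hgt P u + q) * tsin P u)); [|ring].
  rewrite Hu, H; ring. }
exists F, p, P, (t u0), (- q); split; [now constructor|].
assert (Hts : forall u, J u -> t u0 <> 0 /\ tsin P u <> 0).
{ intros u Ju; pose proof (rad_neq0 _ _ HP u Ju) as H; rewrite (Hf u Ju) in H.
  split; intros H0; apply H; rewrite H0; ring. }
split; [apply (Hts u0 Ju0)|]; intros u Ju.
assert (Hw : spd P u = t u0 * trn P u).
{ assert (D : is_derive (hgt P) u (t u0 * trn P u * tsin P u)).
  { apply is_derive_ext_loc with (fun u => - q - t u0 * tcos P u).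
    - apply (filter_imp J); [intros x Jx; symmetry; now apply Hg | now apply HJ].
    - pose proof (tcos_derive _ _ HP u Ju) as Dc.
      assert (ex_derive (tcos P) u) by (eexists; exact Dc).
      auto_derive; [tauto|].
      change (Derive (fun x => tcos P x) u) with (Derive (tcos P) u).
      rewrite (is_derive_unique _ _ _ Dc); ring. }
  apply is_derive_unique in D.
  rewrite (is_derive_unique _ _ _ (hgt_derive _ _ HP u Ju)) in D.
  now apply Rmult_eq_reg_r in D; [|apply (Hts u Ju)]. }
repeat split; auto; [|apply (Hts u Ju)].
intros H; apply (spd_neq0 _ _ HP u Ju); rewrite Hw, H; ring.
Qed.

Lemma generated_spherical (J : R -> Prop) (F : frame) (p : vec3) (P : profile) (sg m : R)
    (X : R -> R -> vec3) :
  interval J -> (exists u, J u) -> generated J F p P sg X ->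
  (forall u, J u -> rad P u = m * tsin P u) ->
  (forall u, J u -> spd P u = m * trn P u) ->
  spherical J X.
Proof.
intros HJ Hne G Hf Hw; split; [now apply (generated_surface_of_revolution J F p P sg)|].
destruct Hne as [u0 Ju0], G as [HP E _ _].
assert (Hm : m <> 0).
{ intros Hm; apply (rad_neq0 _ _ HP u0 Ju0); rewrite Hf, Hm by trivial; ring. }
set (q := hgt P u0 + m * tcos P u0).
assert (Hg : forall u, J u -> hgt P u + m * tcos P u = q).
{ intros u Ju; apply (constant_of_derive_zero J (fun u => hgt P u + m * tcos P u) HJ); trivial.
  intros t Jt.
  replace 0 with (spd P t * tsin P t + m * - (trn P t * tsin P t))
    by (rewrite Hw by trivial; ring).
  apply @is_derive_plus; [now apply (hgt_derive _ _ HP)|].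
  apply is_derive_scal; now apply (tcos_derive _ _ HP). }
exists (plus p (scal q (fe3 F))), (Rabs m); split; [now apply Rabs_pos_lt|].
intros u v Ju.
replace (minus _ _) with (comb (turn F v) (m * tsin P u) 0 (- (m * tcos P u))).
- unfold enorm; rewrite dot_comb, <- sqrt_Rsqr_abs; f_equal; unfold Rsqr.
  transitivity (m * m * (tcos P u * tcos P u + tsin P u * tsin P u)); [ring|].
  rewrite (tangent_unit _ _ HP u Ju); ring.
- rewrite E, <- (Hg u Ju), <- (Hf u Ju) by trivial; unfold revolving.
  rewrite !comb_turn; vec_ring.
Qed.

(** The principal radii of a catenoid are opposite, so that the parallel surface at
    distance [mu] degenerates exactly where [rad] is [mu * tsin] or
    [- mu * tsin]. *)
Lemma catenoid_parallel_generated (J : R -> Prop) (X : R -> R -> vec3) :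
  interval J -> (exists u, J u) -> catenoid_parallel J X ->
  exists F p P mu sg, mu <> 0 /\ regular_profile J P /\
    generated J F p (parallel_profile P mu) sg X /\
    forall u, J u -> trn P u <> 0 /\ tsin P u <> 0 /\
      rad P u * trn P u + spd P u * tsin P u = 0.
Proof.
intros HJ Hne [Y [HY [mu [Hmu [Hpar HX]]]]].
destruct (catenoid_generated J Y HJ Hne HY) as [F [p [P [G Hrel]]]].
destruct HY as [_ [Hmin _]].
pose proof (generated_regular _ _ _ _ _ _ G) as HP.
assert (Hn : forall u, J u -> rad P u - mu * tsin P u <> 0 /\ spd P u - mu * trn P u <> 0).
{ intros u Ju; specialize (Hpar u 0 Ju); rewrite (Hmin u 0 Ju) in Hpar.
  rewrite (generated_gauss_curvature (proj1 HJ) G) in Hpar by trivial.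
  pose proof (rad_neq0 _ _ HP u Ju) as Hf; pose proof (spd_neq0 _ _ HP u Ju) as Hw.
  destruct (Hrel u Ju) as [Hk [Hs H]].
  assert (Ek : trn P u = - (spd P u * tsin P u) / rad P u)
    by (apply Rmult_eq_reg_l with (rad P u); trivial;
        transitivity (- (spd P u * tsin P u)); [lra | field; trivial]).
  rewrite Ek in *.
  split; intros H0; apply Hpar.
  - replace (rad P u) with (mu * tsin P u) by lra; field; repeat split; trivial.
  - assert (Ef : rad P u = - (mu * tsin P u)).
    { assert (H1 : spd P u * (rad P u + mu * tsin P u) / rad P u = 0)
        by (rewrite <- H0; field; trivial).
      assert (H2 : spd P u * (rad P u + mu * tsin P u) = 0).
      { transitivity (spd P u * (rad P u + mu * tsin P u) / rad P u * rad P u);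
          [field; trivial | rewrite H1; ring]. }
      apply Rmult_integral in H2; destruct H2 as [H2|H2]; [tauto | lra]. }
    rewrite Ef; field; repeat split; trivial. }
destruct (generated_exists_sign J F p (parallel_profile P mu) X HJ Hne) as [sg G'].
- apply regular_parallel_profile; [apply HJ | trivial | apply Hn | apply Hn].
- intros u v Ju.
  rewrite HX, (generated_normal (proj1 HJ) G), (generated_eq _ _ _ _ _ _ G) by trivial.
  rewrite plus_revolving_parallel; now rewrite Rmult_1_r.
- now exists F, p, P, mu, sg.
Qed.

(** * Eigenfields of the Laplacian of III *)

Lemma revolving_nonconstant (J : R -> Prop) (F : frame) (a b : R -> R) (u : R) :
  J u -> a u <> 0 ->
  exists u v u' v', J u /\ J u' /\
    revolving F a (fun _ => 0) b u v <> revolving F a (fun _ => 0) b u' v'.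
Proof.
intros Ju Ha; exists u, 0, u, PI; do 2 (split; trivial).
unfold revolving; rewrite !comb_turn, cos_0, sin_0, cos_PI, sin_PI; intros H.
apply (f_equal (dot (comb F 1 0 0))) in H; rewrite !dot_comb in H; lra.
Qed.

(** What a decomposition asks of each of its nonconstant terms. *)
Definition eigenfield (J : R -> Prop) (X Y : R -> R -> vec3) (lambda : R) : Prop :=
  vsmooth2 J Y /\
  (forall u v, J u -> Y u (v + 2 * PI) = Y u v) /\
  (exists u v u' v', J u /\ J u' /\ Y u v <> Y u' v') /\
  (forall u v, J u -> III_vlaplacian X Y u v = scal lambda (Y u v)).

(** The normal is the position vector of the unit sphere, whose metric is [III]:
    its components are spherical harmonics of degree one, of eigenvalue 2. *)
Lemma normal_eigenfield (J : R -> Prop) (F : frame) (p : vec3) (P : profile) (sg m : R)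
    (X : R -> R -> vec3) :
  open J -> (exists u, J u) -> generated J F p P sg X -> m <> 0 ->
  (forall u, J u -> trn P u <> 0) -> (forall u, J u -> tsin P u <> 0) ->
  eigenfield J X
    (revolving F (fun u => - (m * tsin P u)) (fun _ => 0) (fun u => m * tcos P u)) 2.
Proof.
intros HJ [u0 Ju0] G Hm Hk Hs.
pose proof (generated_regular _ _ _ _ _ _ G) as HP.
split; [|split; [|split]].
- apply vsmooth2_revolving; trivial.
  + apply smooth1_opp; trivial; apply smooth1_scal; trivial; apply (tsin_smooth _ _ HP).
  + now apply smooth1_const.
  + apply smooth1_scal; trivial; apply (tcos_smooth _ _ HP).
- intros u v _; apply comb_turn_period.
- apply (revolving_nonconstant J F _ _ u0 Ju0).
  apply Ropp_neq_0_compat, Rmult_integral_contrapositive_currified; auto.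
- intros u v Ju.
  rewrite (generated_III_vlaplacian HJ G _ (fun u => - (m * tsin P u)) (fun u => m * tcos P u)
    (fun u => - (m * tcos P u)) (fun u => - (m * tsin P u))
    (fun u => m * tsin P u) (fun u => - (m * tcos P u))); auto.
  + unfold revolving; rewrite scal_comb.
    pose proof (tangent_unit _ _ HP u Ju) as Hu; specialize (Hs u Ju).
    assert (H : tcos P u * tcos P u = 1 - tsin P u * tsin P u) by lra.
    f_equal; [|ring|].
    * transitivity (- (m * tsin P u + m / tsin P u - m * (tcos P u * tcos P u) / tsin P u));
        [field; trivial | rewrite H; field; trivial].
    * field; trivial.
  + intros x Jx; replace (trn P x * _) with (- (m * (trn P x * tcos P x))) by ring.
    apply (is_derive_opp (fun u => m * tsin P u)), is_derive_scal; now apply (tsin_derive _ _ HP).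
  + intros x Jx; replace (trn P x * _) with (m * - (trn P x * tsin P x)) by ring.
    apply is_derive_scal; now apply (tcos_derive _ _ HP).
  + intros x Jx; replace (trn P x * _) with (- (m * - (trn P x * tsin P x))) by ring.
    apply (is_derive_opp (fun u => m * tcos P u)), is_derive_scal; now apply (tcos_derive _ _ HP).
  + intros x Jx; replace (trn P x * _) with (- (m * (trn P x * tcos P x))) by ring.
    apply (is_derive_opp (fun u => m * tsin P u)), is_derive_scal; now apply (tsin_derive _ _ HP).
Qed.

(** The spherical image of a minimal surface is conformal, so that the harmonic
    coordinates of the surface are also harmonic for [III].  Here [(r, h)] is the
    minimal profile and [X] any surface with the same normals, such as a parallel
    surface. *)
Lemma minimal_eigenfield (J : R -> Prop) (F : frame) (p : vec3) (P : profile) (sg : R)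
    (X : R -> R -> vec3) (r h w : R -> R) :
  open J -> (exists u, J u) -> generated J F p P sg X ->
  (forall u, J u -> trn P u <> 0) -> (forall u, J u -> tsin P u <> 0) ->
  smooth1 J r -> smooth1 J h ->
  (forall u, J u -> is_derive r u (w u * tcos P u)) ->
  (forall u, J u -> is_derive h u (w u * tsin P u)) ->
  (forall u, J u -> r u <> 0) ->
  (forall u, J u -> r u * trn P u + w u * tsin P u = 0) ->
  eigenfield J X (revolving F r (fun _ => 0) h) 0.
Proof.
intros HJ [u0 Ju0] G Hk Hs Sr Sh Dr Dh Hr Hrel.
pose proof (generated_regular _ _ _ _ _ _ G) as HP.
assert (Hw : forall u, J u -> w u = - (r u * trn P u) / tsin P u).
{ intros u Ju; apply Rmult_eq_reg_r with (tsin P u); auto.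
  transitivity (- (r u * trn P u)); [specialize (Hrel u Ju); lra | field; auto]. }
split; [|split; [|split]].
- apply vsmooth2_revolving; trivial; now apply smooth1_const.
- intros u v _; apply comb_turn_period.
- apply (revolving_nonconstant J F _ _ u0 Ju0); auto.
- intros u v Ju.
  rewrite (generated_III_vlaplacian HJ G _ r h
    (fun u => - (r u * tcos P u) / tsin P u) (fun u => - r u)
    (fun u => r u + 2 * r u * (tcos P u * tcos P u) / (tsin P u * tsin P u))
    (fun u => r u * tcos P u / tsin P u)); auto.
  + unfold revolving; rewrite scal_comb.
    pose proof (tangent_unit _ _ HP u Ju) as Hu; specialize (Hs u Ju).
    assert (H : tcos P u * tcos P u = 1 - tsin P u * tsin P u) by lra.
    f_equal; [|ring|].
    * rewrite H.
      transitivity (- (r u + r u * (1 - 2 * (tsin P u * tsin P u)) / (tsin P u * tsin P u)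
        - r u * (tcos P u * tcos P u) / (tsin P u * tsin P u))); [field; trivial|].
      rewrite H; field; trivial.
    * field; trivial.
  + intros x Jx; replace (trn P x * _) with (w x * tcos P x); auto.
    rewrite Hw by trivial; field; auto.
  + intros x Jx; replace (trn P x * _) with (w x * tsin P x); auto.
    rewrite Hw by trivial; field; auto.
  + intros x Jx.
    pose proof (tangent_unit _ _ HP x Jx) as Hu; pose proof (Hs x Jx) as Hsx.
    pose proof (Dr x Jx) as D1; pose proof (tcos_derive _ _ HP x Jx) as D2.
    pose proof (tsin_derive _ _ HP x Jx) as D3.
    assert (ex_derive r x) by (eexists; exact D1).
    assert (ex_derive (tcos P) x) by (eexists; exact D2).
    assert (ex_derive (tsin P) x) by (eexists; exact D3).
    auto_derive; [tauto|].
    change (Derive (fun x => r x) x) with (Derive r x).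
    change (Derive (fun x => tcos P x) x) with (Derive (tcos P) x).
    change (Derive (fun x => tsin P x) x) with (Derive (tsin P) x).
    rewrite (is_derive_unique _ _ _ D1), (is_derive_unique _ _ _ D2),
      (is_derive_unique _ _ _ D3), Hw by trivial.
    field; trivial.
  + intros x Jx; replace (trn P x * _) with (- (w x * tcos P x)).
    * apply (is_derive_opp r); auto.
    * rewrite Hw by trivial; field; auto.
Qed.

Lemma finite_type_1 (J : R -> Prop) (X Y : R -> R -> vec3) (x0 : vec3) (lambda : R) :
  eigenfield J X Y lambda -> (forall u v, J u -> X u v = plus x0 (Y u v)) ->
  III_decomposition J X 1 (fun i => match i with O => fun _ _ => x0 | _ => Y end)
    (fun _ => lambda).
Proof.
intros HY E; split; [|split; [|split]].
- now exists x0.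
- intros [|i] Hi; [lia | exact HY].
- intros; lia.
- intros u v Ju; rewrite sum_Sn, sum_O; now apply E.
Qed.

Lemma finite_type_2 (J : R -> Prop) (X Y Z : R -> R -> vec3) (x0 : vec3) (l m : R) :
  eigenfield J X Y l -> eigenfield J X Z m -> l <> m ->
  (forall u v, J u -> X u v = plus (plus x0 (Y u v)) (Z u v)) ->
  III_decomposition J X 2
    (fun i => match i with O => fun _ _ => x0 | 1%nat => Y | _ => Z end)
    (fun i => match i with 1%nat => l | _ => m end).
Proof.
intros HY HZ Hlm E; split; [|split; [|split]].
- now exists x0.
- intros [|[|i]] Hi; [lia | exact HY | exact HZ].
- intros [|[|[|i]]] [|[|[|j]]] Hi Hj Hij; try lia; auto.
- intros u v Ju; rewrite !sum_Sn, sum_O; now apply E.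
Qed.

Lemma spherical_type (J : R -> Prop) (X : R -> R -> vec3) :
  interval J -> (exists u, J u) -> spherical J X -> finite_III_type J X 1.
Proof.
intros HJ Hne HX.
destruct (spherical_generated J X HJ Hne HX) as [F [p [P [t [q [G [Ht H]]]]]]].
eexists; eexists; eapply finite_type_1.
- apply (normal_eigenfield J F p P 1 (- t) X (proj1 HJ) Hne G); try apply H.
  lra.
- intros u v Ju; destruct (H u Ju) as [_ [_ [Hf [_ Hg]]]].
  rewrite (generated_eq _ _ _ _ _ _ G) by trivial.
  unfold revolving; rewrite Hf, Hg, !comb_turn.
  instantiate (1 := plus p (scal q (fe3 F))); vec_ring.
Qed.

Lemma catenoid_type (J : R -> Prop) (X : R -> R -> vec3) :
  interval J -> (exists u, J u) -> catenoid J X -> finite_null_III_type J X 1.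
Proof.
intros HJ Hne HX.
destruct (catenoid_generated J X HJ Hne HX) as [F [p [P [G H]]]].
pose proof (generated_regular _ _ _ _ _ _ G) as [].
eexists; eexists; split; [|exists 1%nat; split; [lia|]].
- apply (finite_type_1 J X (revolving F (rad P) (fun _ => 0) (hgt P)) p 0).
  + apply (minimal_eigenfield J F p P 1 X (rad P) (hgt P) (spd P) (proj1 HJ) Hne G);
      trivial; apply H.
  + apply (generated_eq _ _ _ _ _ _ G).
- reflexivity.
Qed.

Lemma catenoid_parallel_type (J : R -> Prop) (X : R -> R -> vec3) :
  interval J -> (exists u, J u) -> catenoid_parallel J X -> finite_null_III_type J X 2.
Proof.
intros HJ Hne HX.
destruct (catenoid_parallel_generated J X HJ Hne HX)
  as [F [p [P [mu [sg [Hmu [HP [G H]]]]]]]].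
destruct HP.
eexists; eexists; split; [|exists 1%nat; split; [lia|]].
- apply (finite_type_2 J X (revolving F (rad P) (fun _ => 0) (hgt P))
    (revolving F (fun u => - (mu * tsin P u)) (fun _ => 0) (fun u => mu * tcos P u)) p 0 2).
  + apply (minimal_eigenfield J F p _ sg X (rad P) (hgt P) (spd P) (proj1 HJ) Hne G);
      trivial; apply H.
  + apply (normal_eigenfield J F p _ sg mu X (proj1 HJ) Hne G); trivial; apply H.
  + lra.
  + intros u v Ju; rewrite (generated_eq _ _ _ _ _ _ G) by trivial.
    unfold revolving, parallel_profile; simpl; vec_ring.
- reflexivity.
Qed.

(** * Surfaces with constant sum of the principal radii *)

Lemma spherical_constant_sum_radii (J : R -> Prop) (X : R -> R -> vec3) :
  interval J -> (exists u, J u) -> spherical J X ->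
  no_parabolic_points J X /\ constant_sum_radii J X.
Proof.
intros HJ Hne HX.
destruct (spherical_generated J X HJ Hne HX) as [F [p [P [t [q [G [Ht H]]]]]]].
split.
- intros u v Ju; apply (generated_curvature_neq0 (proj1 HJ) G u v Ju).
  split; now apply H.
- exists (2 * t); intros u v Ju.
  destruct (H u Ju) as [Hk [Hs [Hf [Hw _]]]].
  rewrite (generated_sum_radii (proj1 HJ) G u v Ju Hk Hs), Hf, Hw; field; auto.
Qed.

Lemma minimal_sum_radii (f w k s : R) :
  k <> 0 -> s <> 0 -> f * k + w * s = 0 -> w / k + f / s = 0.
Proof.
intros Hk Hs H; transitivity ((f * k + w * s) / (k * s)); [field; auto|].
rewrite H; field; auto.
Qed.

Lemma catenoid_constant_sum_radii (J : R -> Prop) (X : R -> R -> vec3) :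
  interval J -> (exists u, J u) -> catenoid J X ->
  no_parabolic_points J X /\ constant_sum_radii J X.
Proof.
intros HJ Hne HX.
destruct (catenoid_generated J X HJ Hne HX) as [F [p [P [G H]]]].
split.
- intros u v Ju; apply (generated_curvature_neq0 (proj1 HJ) G u v Ju).
  split; now apply H.
- exists 0; intros u v Ju.
  destruct (H u Ju) as [Hk [Hs Hrel]].
  rewrite (generated_sum_radii (proj1 HJ) G u v Ju Hk Hs), minimal_sum_radii; trivial; ring.
Qed.

Lemma catenoid_parallel_constant_sum_radii (J : R -> Prop) (X : R -> R -> vec3) :
  interval J -> (exists u, J u) -> catenoid_parallel J X ->
  surface_of_revolution J X /\ no_parabolic_points J X /\ constant_sum_radii J X.
Proof.
intros HJ Hne HX.
destruct (catenoid_parallel_generated J X HJ Hne HX)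
  as [F [p [P [mu [sg [Hmu [HP [G H]]]]]]]].
split; [now apply (generated_surface_of_revolution J F p (parallel_profile P mu) sg)|split].
- intros u v Ju; apply (generated_curvature_neq0 (proj1 HJ) G u v Ju).
  split; now apply H.
- exists (- 2 * mu * sg); intros u v Ju.
  destruct (H u Ju) as [Hk [Hs Hrel]].
  rewrite (generated_sum_radii (proj1 HJ) G u v Ju Hk Hs); simpl.
  transitivity (sg * (spd P u / trn P u + rad P u / tsin P u) - 2 * mu * sg);
    [field; auto|].
  rewrite minimal_sum_radii; trivial; ring.
Qed.

(** With [2 m] the constant sum of the radii, the parallel surface at distance [m]
    has opposite radii, as far as it is a surface: its profile has
    [rad * tsin] constant, and a zero constant means that the parallel surface
    is a point. *)
Lemma parallel_rad_tsin_constant (J : R -> Prop) (P : profile) (m : R) :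
  interval J -> regular_profile J P ->
  (forall u, J u -> trn P u <> 0) -> (forall u, J u -> tsin P u <> 0) ->
  (forall u, J u -> spd P u / trn P u + rad P u / tsin P u = 2 * m) ->
  forall u t, J u -> J t ->
    (rad P u - m * tsin P u) * tsin P u = (rad P t - m * tsin P t) * tsin P t.
Proof.
intros HJ HP Hk Hs HR.
apply (constant_of_derive_zero J (fun u => (rad P u - m * tsin P u) * tsin P u) HJ).
intros u Ju.
pose proof (rad_derive _ _ HP u Ju) as D1; pose proof (tsin_derive _ _ HP u Ju) as D2.
assert (ex_derive (rad P) u) by (eexists; exact D1).
assert (ex_derive (tsin P) u) by (eexists; exact D2).
auto_derive; [tauto|].
change (Derive (fun x => rad P x) u) with (Derive (rad P) u).
change (Derive (fun x => tsin P x) u) with (Derive (tsin P) u).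
rewrite (is_derive_unique _ _ _ D1), (is_derive_unique _ _ _ D2).
transitivity (tcos P u * trn P u * tsin P u
  * (spd P u / trn P u + rad P u / tsin P u - 2 * m)); [field; auto|].
rewrite HR by trivial; ring.
Qed.

Lemma constant_sum_radii_classification (J : R -> Prop) (X : R -> R -> vec3) :
  interval J -> (exists u, J u) -> surface_of_revolution J X ->
  no_parabolic_points J X -> constant_sum_radii J X ->
  spherical J X \/ catenoid J X \/ catenoid_parallel J X.
Proof.
intros HJ Hne HS HK [R0 HR].
destruct (surface_of_revolution_generated J X (proj1 HJ) HS) as [F [p [P G]]].
pose proof (generated_regular _ _ _ _ _ _ G) as HP.
assert (Hks : forall u, J u -> trn P u <> 0 /\ tsin P u <> 0)
  by (intros u Ju; apply (generated_curvature_neq0 (proj1 HJ) G u 0 Ju); now apply HK).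
set (m := R0 / 2).
assert (Hm : forall u, J u -> spd P u / trn P u + rad P u / tsin P u = 2 * m).
{ intros u Ju; destruct (Hks u Ju) as [Hk Hs].
  rewrite <- (Rmult_1_l (_ + _)), <- (generated_sum_radii (proj1 HJ) G u 0 Ju Hk Hs).
  rewrite HR by trivial; unfold m; field. }
assert (Hw : forall u, J u -> spd P u = trn P u * (2 * m - rad P u / tsin P u)).
{ intros u Ju; rewrite <- (Hm u Ju); field; split; now apply Hks. }
destruct Hne as [u0 Ju0]; pose proof (ex_intro _ u0 Ju0 : exists u, J u) as Hne.
assert (HC : forall u, J u -> (rad P u - m * tsin P u) * tsin P u
  = (rad P u0 - m * tsin P u0) * tsin P u0).
{ intros; apply (parallel_rad_tsin_constant J P m); trivial; apply Hks. }
destruct (Req_dec ((rad P u0 - m * tsin P u0) * tsin P u0) 0) as [H0|H0].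
- left.
  assert (Hf : forall u, J u -> rad P u = m * tsin P u).
  { intros u Ju; specialize (HC u Ju); rewrite H0 in HC.
    apply Rmult_integral in HC; destruct HC as [HC|HC]; [lra|].
    now apply Hks in HC. }
  apply (generated_spherical J F p P 1 m); trivial.
  intros u Ju; rewrite Hw, Hf by trivial; field; now apply Hks.
- right.
  assert (Hf : forall u, J u -> rad P u - m * tsin P u <> 0).
  { intros u Ju H; apply H0; rewrite <- (HC u Ju), H; ring. }
  destruct (Req_dec m 0) as [Hm0|Hm0].
  + left; apply (generated_catenoid J F p P 1); trivial; [apply Hks|].
    intros u Ju; rewrite (Hw u Ju), Hm0; field; now apply Hks.
  + right.
    set (Q := parallel_profile P m).
    assert (Hw' : forall u, J u -> spd Q u = - (trn P u * rad Q u / tsin P u)).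
    { intros u Ju; simpl; rewrite (Hw u Ju); field; now apply Hks. }
    assert (HQ : regular_profile J Q).
    { apply regular_parallel_profile; trivial; [apply HJ|].
      intros u Ju; specialize (Hw' u Ju); simpl in Hw'; rewrite Hw'.
      destruct (Hks u Ju).
      apply Ropp_neq_0_compat; unfold Rdiv.
      repeat apply Rmult_integral_contrapositive_currified; auto using Rinv_neq_0_compat. }
    set (Y := fun u v => plus p (revolving F (rad Q) (fun _ => 0) (hgt Q) u v)).
    destruct (generated_exists_sign J F p Q Y HJ Hne HQ) as [sg GY]; [reflexivity|].
    pose proof (generated_sign_sqr GY) as Hsg.
    assert (Hrel : forall u, J u -> rad Q u * trn Q u + spd Q u * tsin Q u = 0).
    { intros u Ju; rewrite Hw' by trivial; simpl; field; now apply Hks. }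
    assert (HY : catenoid J Y).
    { apply (generated_catenoid J F p Q sg); trivial; apply Hks. }
    exists Y; split; trivial.
    exists (- m * sg); split; [|split].
    * intros H; apply Hm0; transitivity (- ((- m * sg) * sg));
        [transitivity (m * (sg * sg)); [rewrite Hsg; ring | ring] | rewrite H; ring].
    * intros u v Ju; destruct HY as [_ [Hmin _]].
      rewrite (Hmin u v Ju), (generated_gauss_curvature (proj1 HJ) GY u v Ju), Hw' by trivial.
      destruct (Hks u Ju) as [Hk Hs]; pose proof (Hf u Ju) as Hfu.
      change (rad Q u) with (rad P u - m * tsin P u).
      change (trn Q u) with (trn P u); change (tsin Q u) with (tsin P u).
      (* The numerator is [rad * (rad - 2 m tsin)], and the constancy of the sum of
         the radii turns its second factor into [- spd * tsin / trn]. *)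
      replace (_ + _) with (- (rad P u * (spd P u * tsin P u / trn P u))
        / ((rad P u - m * tsin P u) * (rad P u - m * tsin P u))).
      -- pose proof (rad_neq0 _ _ HP u Ju); pose proof (spd_neq0 _ _ HP u Ju).
         unfold Rdiv; repeat first [ apply Rmult_integral_contrapositive_currified
           | apply Ropp_neq_0_compat | apply Rinv_neq_0_compat ]; trivial.
      -- transitivity (1 - (sg * sg) * (m * m) * (tsin P u * tsin P u)
           / ((rad P u - m * tsin P u) * (rad P u - m * tsin P u))).
         ++ rewrite Hsg, (Hw u Ju); field; auto.
         ++ field; auto.
    * intros u v Ju.
      rewrite (generated_normal (proj1 HJ) GY u v Ju).
      unfold Y; rewrite plus_revolving_parallel.
      rewrite (generated_eq _ _ _ _ _ _ G u v Ju); unfold revolving, Q; simpl.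
      replace (- m * sg * sg) with (- m * (sg * sg)) by ring; rewrite Hsg.
      do 2 f_equal; ring.
Qed.

Theorem theorem3 (a b : Rbar) (hab : Rbar_lt a b) (X : R -> R -> vec3) :
  let J := parameter_interval a b in
  ((surface_of_revolution J X /\ no_parabolic_points J X /\
    constant_sum_radii J X)
   <-> (spherical J X \/ catenoid J X \/ catenoid_parallel J X)) /\
  (spherical J X -> finite_III_type J X 1) /\
  (catenoid J X -> finite_null_III_type J X 1) /\
  (catenoid_parallel J X -> finite_null_III_type J X 2).
Proof.
intros J.
assert (HJ : interval J) by apply parameter_interval_interval.
assert (Hne : exists u, J u) by now apply parameter_interval_nonempty.
repeat split.
- intros [HS [HK HR]]; now apply constant_sum_radii_classification.
- destruct H as [[H _]|[[H _]|H]]; trivial.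
  now apply catenoid_parallel_constant_sum_radii.
- destruct H as [H|[H|H]];
    [ now apply spherical_constant_sum_radii | now apply catenoid_constant_sum_radii
    | now apply catenoid_parallel_constant_sum_radii ].
- destruct H as [H|[H|H]];
    [ now apply spherical_constant_sum_radii | now apply catenoid_constant_sum_radii
    | now apply catenoid_parallel_constant_sum_radii ].
- now apply spherical_type.
- now apply catenoid_type.
- now apply catenoid_parallel_type.
Qed.
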